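(* Let $M$ be a connected smooth $2$-manifold and let $\boldsymbol{x}\colon M\to\mathbb{R}^3$ be a smooth immersion with Gaussian curvature function $K$, such that $M$ has no (nonempty) open subset on which $\operatorname{grad}K=0$. Suppose that $\boldsymbol{x}$ has parallel $K$-contours. If the area element $dA$ of $\boldsymbol{x}$ is invariant along each $K$-contour, then $\boldsymbol{x}$ is locally congruent to a surface $\boldsymbol{p}_{k,c}$ for some nonzero real numbers $k,c$.
   Context: For an immersion $\boldsymbol{x}\colon M\to\mathbb{R}^3$ with Gaussian curvature $K\colon M\to\mathbb{R}$, put $M_\kappa=\{p\in M\mid K(p)=\kappa\}$ for $\kappa\in\mathbb{R}$; these sets are the $K$-contours, and $\mathcal{C}=\{M_\kappa\}_{\kappa\in\mathbb{R}}$. Parallel $K$-contours: $\boldsymbol{x}$ has parallel $K$-contours if there exists a plane $P\subset\mathbb{R}^3$ such that the orthogonal projection $\pi\colon\mathbb{R}^3\to P$ maps $\mathcal{C}$ to a family of parallel straight lines on $P$. Invariance of the area element: let $(x,y)$ be Cartesian coordinates on $P$ such that the parallel lines are lines $x=\text{const}$, used (via $\pi\circ\boldsymbol{x}$) as local coordinates on $M$ wherever possible, so that the surface is locally a graph over $P$. Write $dA=\varDelta\,dx\wedge dy$. ''$dA$ is invariant along each $K$-contour'' means that $\varDelta$ does not depend on $y$, i.e. $\varDelta$ is locally a function of $x$ alone. The surface $\boldsymbol{p}_{k,c}$: for nonzero real numbers $k,c$, $$\boldsymbol{p}_{k,c}(x,y)=\left(x,\ y,\ c\,e^{kx}\cos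 ky\right),\qquad (x,y)\in\mathbb{R}^2.$$ Locally congruent means: locally equal, up to reparametrization and a rigid motion of $\mathbb{R}^3$, to a piece of the indicated surface. *)

(* Defs.v *)
From mathcomp Require Import all_boot all_order all_algebra.
From mathcomp Require Import all_classical all_reals all_analysis.
Import Order.TTheory GRing.Theory Num.Theory.
Import numFieldNormedType.Exports.

Set Implicit Arguments.
Unset Strict Implicit.
Unset Printing Implicit Defensive.

Local Open Scope classical_set_scope.
Local Open Scope ring_scope.

(** * Euclidean space

The library norm on ['rV_n] is the sup norm, so the Euclidean structure of
[R^3] is spelled out. *)

Definition dot (R : realType) (n : nat) (v w : 'rV[R]_n) : R :=
  \sum_(i < n) v 0 i * w 0 i.

Definition enorm (R : realType) (n : nat) (v : 'rV[R]_n) : R :=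
  Num.sqrt (dot v v).

Definition row3 (R : realType) (a b c : R) : 'rV[R]_3 :=
  \row_j [:: a; b; c]`_j.

Definition cross (R : realType) (v w : 'rV[R]_3) : 'rV[R]_3 :=
  let a (u : 'rV[R]_3) k := u 0 (inord k) in
  row3 (a v 1%N * a w 2%N - a v 2%N * a w 1%N)
       (a v 2%N * a w 0%N - a v 0%N * a w 2%N)
       (a v 0%N * a w 1%N - a v 1%N * a w 0%N).

(** * Smooth functions on open subsets of [R^2] *)

Definition partial (R : realType) (W : normedModType R) (i : 'I_2)
    (f : 'rV[R]_2 -> W) : 'rV[R]_2 -> W :=
  'D_(delta_mx 0 i) f.

(** [C^oo] on an open set [D]: all iterated partial derivatives exist and are
(Frechet) differentiable, hence continuous, at every point of [D]. *)
Definition smooth_on (R : realType) (W : normedModType R) (D : set 'rV[R]_2)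
    (f : 'rV[R]_2 -> W) : Prop :=
  forall (s : seq 'I_2) (u : 'rV[R]_2), D u ->
    differentiable (foldr (@partial R W) f s) u.

(** * Smooth 2-manifolds *)

(** Both maps are total functions; only the values of [cmap] on [cdom] and of
[cinv] on [cran] are meaningful. *)
Record chart (R : realType) (M : topologicalType) := Chart {
  cdom : set M;
  cmap : M -> 'rV[R]_2;
  cinv : 'rV[R]_2 -> M }.

Definition cran (R : realType) (M : topologicalType) (phi : chart R M) :
  set 'rV[R]_2 := cmap phi @` cdom phi.

Definition is_chart (R : realType) (M : topologicalType) (phi : chart R M) :
    Prop :=
  [/\ open (cdom phi) /\ open (cran phi),
      forall p, cdom phi p -> cinv phi (cmap phi p) = p,
      forall p, cdom phi p -> {for p, continuous (cmap phi)}
    & forall u, cran phi u -> {for u, continuous (cinv phi)}].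

Definition smooth_transition (R : realType) (M : topologicalType)
    (phi psi : chart R M) : Prop :=
  smooth_on (cmap phi @` (cdom phi `&` cdom psi)) (cmap psi \o cinv phi).

Definition smooth_surface (R : realType) (M : topologicalType)
    (A : set (chart R M)) : Prop :=
  [/\ hausdorff_space M, @second_countable M,
      forall phi, A phi -> is_chart phi,
      forall p, exists2 phi, A phi & cdom phi p
    & forall phi psi, A phi -> A psi -> smooth_transition phi psi].

(** Membership in the maximal atlas generated by [A]. *)
Definition smooth_chart (R : realType) (M : topologicalType)
    (A : set (chart R M)) (phi : chart R M) : Prop :=
  is_chart phi /\ forall psi, A psi ->
    smooth_transition phi psi /\ smooth_transition psi phi.

(** * Parametrized surfaces [F] in [R^3] *)

Definition first_form (R : realType) (F : 'rV[R]_2 -> 'rV[R]_3)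
    (u : 'rV[R]_2) : 'M[R]_2 :=
  \matrix_(i, j) dot (partial i F u) (partial j F u).

Definition unit_normal (R : realType) (F : 'rV[R]_2 -> 'rV[R]_3)
    (u : 'rV[R]_2) : 'rV[R]_3 :=
  let w := cross (partial 0 F u) (partial 1 F u) in (enorm w)^-1 *: w.

Definition second_form (R : realType) (F : 'rV[R]_2 -> 'rV[R]_3)
    (u : 'rV[R]_2) : 'M[R]_2 :=
  \matrix_(i, j) dot (partial i (partial j F) u) (unit_normal F u).

Definition gauss_curvature (R : realType) (F : 'rV[R]_2 -> 'rV[R]_3)
    (u : 'rV[R]_2) : R :=
  \det (second_form F u) / \det (first_form F u).

(** Coordinates [sum_i g^(ij) d_i k] of the gradient of [k] for the metric
induced by [F]. *)
Definition gradient (R : realType) (F : 'rV[R]_2 -> 'rV[R]_3)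
    (k : 'rV[R]_2 -> R^o) (u : 'rV[R]_2) : 'rV[R]_2 :=
  (\row_i (partial i k u : R)) *m invmx (first_form F u).

(** The density [Delta] in [dA = Delta du /\ dv]. *)
Definition area_density (R : realType) (F : 'rV[R]_2 -> 'rV[R]_3)
    (u : 'rV[R]_2) : R :=
  Num.sqrt (\det (first_form F u)).

(** * Immersed surfaces *)

Definition smooth_immersion (R : realType) (M : topologicalType)
    (A : set (chart R M)) (x : M -> 'rV[R]_3) : Prop :=
  forall phi, A phi ->
    smooth_on (cran phi) (x \o cinv phi) /\
    forall u, cran phi u ->
      row_free (\matrix_(i < 2) partial i (x \o cinv phi) u).

(** The curvature of a parametrized surface does not change under
reparametrization, so this determines [K] uniquely. *)
Definition is_gauss_curvature (R : realType) (M : topologicalType)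
    (A : set (chart R M)) (x : M -> 'rV[R]_3) (K : M -> R) : Prop :=
  forall phi p, A phi -> cdom phi p ->
    K p = gauss_curvature (x \o cinv phi) (cmap phi p).

Definition grad_vanishes_at (R : realType) (M : topologicalType)
    (A : set (chart R M)) (x : M -> 'rV[R]_3) (K : M -> R) (p : M) : Prop :=
  forall phi, A phi -> cdom phi p ->
    gradient (x \o cinv phi) (K \o cinv phi) (cmap phi p) = 0.

Definition K_contour (R : realType) (M : topologicalType) (K : M -> R)
    (kappa : R) : set M := [set p | K p = kappa].

(** * Planes with Cartesian coordinates

[(o, e1, e2)] stands for the plane [o + <e1, e2>] with the Cartesian
coordinates [(a, b) |-> o + a e1 + b e2]. *)

Definition cartesian_frame (R : realType) (e1 e2 : 'rV[R]_3) : Prop :=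
  [/\ dot e1 e1 = 1, dot e2 e2 = 1 & dot e1 e2 = 0].

Definition plane_point (R : realType) (o e1 e2 : 'rV[R]_3) (a b : R) :
  'rV[R]_3 := o + a *: e1 + b *: e2.

Definition plane_proj (R : realType) (o e1 e2 : 'rV[R]_3) (q : 'rV[R]_3) :
    'rV[R]_3 :=
  plane_point o e1 e2 (dot (q - o) e1) (dot (q - o) e2).

(** The line of the plane on which the first coordinate equals [a]. *)
Definition coord_line (R : realType) (o e1 e2 : 'rV[R]_3) (a : R) :
  set 'rV[R]_3 := range (plane_point o e1 e2 a).

(** One level set of [K] may project to pieces of several of the parallel
lines (this happens for the surfaces [p_surface k c] themselves), so the
inclusion in a single line is required of each connected component. *)
Definition parallel_K_contours (R : realType) (M : topologicalType)
    (x : M -> 'rV[R]_3) (K : M -> R) (o e1 e2 : 'rV[R]_3) : Prop :=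
  forall (kappa : R) (p : M), K_contour K kappa p ->
    exists a : R,
      (plane_proj o e1 e2 \o x) @` connected_component (K_contour K kappa) p
      `<=` coord_line o e1 e2 a.

(** The charts [phi] considered are exactly those given by the coordinates
[(x, y)] of the plane composed with the projection of the surface. *)
Definition area_invariant (R : realType) (M : topologicalType)
    (A : set (chart R M)) (x : M -> 'rV[R]_3) (o e1 e2 : 'rV[R]_3) : Prop :=
  forall phi, smooth_chart A phi ->
    (forall p, cdom phi p ->
       plane_proj o e1 e2 (x p) =
       plane_point o e1 e2 (cmap phi p 0 0) (cmap phi p 0 1)) ->
    forall u, cran phi u ->
      exists g : R -> R,
        \forall v \near u, area_density (x \o cinv phi) v = g (v 0 0).

(** * The model surfaces and congruence *)

Definition p_surface (R : realType) (k c : R) (u : 'rV[R]_2) : 'rV[R]_3 :=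
  row3 (u 0 0) (u 0 1) (c * expR (k * u 0 0) * cos (k * u 0 1)).

(** Near every point, [x] followed by a rigid motion [q |-> q T + b] and read
in suitable smooth coordinates is the restriction of [F]. *)
Definition locally_congruent (R : realType) (M : topologicalType)
    (A : set (chart R M)) (x : M -> 'rV[R]_3) (F : 'rV[R]_2 -> 'rV[R]_3) :
    Prop :=
  forall p : M, exists phi : chart R M,
    [/\ smooth_chart A phi, cdom phi p
      & exists (T : 'M[R]_3) (b : 'rV[R]_3),
          [/\ T *m T^T = 1%:M, \det T = 1
            & forall q, cdom phi q -> x q *m T + b = F (cmap phi q)]].

(* Main.v *)
Require Import Defs.
From HB Require Import structures.
From mathcomp Require Import all_boot all_order all_algebra.
From mathcomp Require Import all_classical all_reals all_analysis.
From mathcomp Require Import ring lra.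
Import Order.TTheory GRing.Theory Num.Theory.
Import numFieldNormedType.Exports.
Local Open Scope classical_set_scope.
Local Open Scope ring_scope.
Set Implicit Arguments.
Unset Strict Implicit.
Unset Printing Implicit Defensive.

(** Where the projection to the plane is regular, the surface is a graph [z = f(x, y)].
Parallel contours and invariance of the area element say that the curvature [K] and
[1 + f_x^2 + f_y^2], hence also [H = f_xx f_yy - f_xy^2], do not depend on [y].
Differentiating gives [f_yy = m f_x] and [f_xy = - m f_y] with
[m = H / (f_x f_xx + f_y f_xy)] independent of [y], and the symmetry of the third
derivatives of [f] forces [m] to be constant.  With [k = - m], the function
[f_x + i f_y] is a constant multiple of [exp (k (x - i y))], so that
[f = (a / k) exp (k x) cos (k (y - s)) + d].

The parameters [k] and [a] are determined by [K = - k^2 w / (1 + w)^2] and by the ratio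
[1 + w] of the area elements of the surface and of the plane, where
[w = (a exp (k x))^2].  Both relations are closed conditions, and they exclude the points
where [K] or the Jacobian of the projection vanishes; a connectedness argument extends them
from one regular point to all of [M].  A regular point exists because [K] vanishes on every
open set where the projection is degenerate. *)

(** * Smooth functions of two variables *)

(** The phase [s] and the height [d] are found on each graph piece separately and may differ from
    piece to piece. They are absorbed into the coordinates and the translation of the congruence at
    each point, so only [k] and [a] have to be the same on all of M. For this reason [normal_form]
    constrains [k] and [a] through K, the metric and X alone. Its second relation is a product with
    the squared Jacobian, not a quotient of area elements: it then makes sense where the projection
    degenerates, passes to limits, and contradicts the immersion property wherever the Jacobian is
    zero.

    The hypothesis on contours concerns components of level sets of K, not derivatives. It is
    exploited by taking x and K as local coordinates at a point where K_y is nonzero, which produces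
    a connected arc of a level set that crosses the lines x = const. The same inverse function
    theorem makes x and y coordinates on M near a regular point. *)

Section smooth_calculus.
Context {R : realType}.
Notation V := 'rV[R]_2.

(** The explicit bound on the remainder is the form in which differentiability is established for
    functions known only near a point and for local inverses. *)
Lemma remainder_differentiable (U W : normedModType R) (f : U -> W)
    (df : {linear U -> W}) (a : U) : continuous df ->
  (forall e : R, 0 < e -> \forall h \near (0 : U), `|f (h + a) - (f a + df h)| <= e * `|h|) ->
  differentiable f a /\ 'd f a = df :> (U -> W).
Proof.
move=> dfc rem.
have E : f \o shift a = cst (f a) + df +o_ 0 id by apply/eqaddoP.
by have dE := diff_unique dfc E; split=> //; apply/diff_locallyP; rewrite dE.
Qed.

Lemma differentiable_remainder (U W : normedModType R) (f : U -> W) (a : U) (e : R) :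
  differentiable f a -> 0 < e ->
  \forall h \near (0 : U), `|f (h + a) - (f a + 'd f a h)| <= e * `|h|.
Proof. by move=> /diff_locally/eqaddoP; apply. Qed.

Lemma near_eq_differentiable (U W : normedModType R) (f g : U -> W) (a : U) :
  {near a, f =1 g} -> differentiable f a -> differentiable g a.
Proof.
move=> fg df; apply: (proj1 (remainder_differentiable (diff_continuous df) _)) => e e0.
have fgh : \forall h \near (0 : U), f (h + a) = g (h + a).
  rewrite (near_shift a); near=> y.
  by rewrite /= sub0r subrK; near: y.
apply: filterS2 fgh (differentiable_remainder df e0) => h.
by rewrite (nbhs_singleton fg) => <-.
Unshelve. all: by end_near. Qed.

Lemma eq_partial (W : normedModType R) (D : set V) (f g : V -> W) i :
  open D -> {in D, f =1 g} -> {in D, partial i f =1 partial i g}.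
Proof.
move=> oD fg u uD; apply: near_eq_derive.
by near=> v; apply: fg; rewrite inE; near: v; apply: open_nbhs_nbhs; split=> //; apply: set_mem.
Unshelve. all: by end_near. Qed.

(** [smooth_on] quantifies over all words of partial derivatives, so induction on the word suffices
    once a class of differentiable functions is closed under [partial]. Closure is asked only up to
    equality on [D]; as [D] is open, such an equality survives further differentiation. *)
Lemma smooth_on_coind (W : normedModType R) (D : set V) (P : (V -> W) -> Prop) :
  open D ->
  (forall f, P f -> (forall u, D u -> differentiable f u) /\
     forall i, exists2 g, P g & {in D, partial i f =1 g}) ->
  forall f, P f -> smooth_on D f.
Proof.
move=> oD Pstep f Pf s u Du.
have [g Pg fg] : exists2 g, P g & {in D, foldr (@partial R W) f s =1 g}.
  elim: s => [|i s [g Pg fg]] /=; first by exists f.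
  have [_ /(_ i)[h Ph gh]] := Pstep _ Pg.
  by exists h => // v vD; rewrite -gh //; exact: (eq_partial i oD fg).
apply: (@near_eq_differentiable _ _ g); last exact: (Pstep _ Pg).1.
near=> v; apply/esym/fg; rewrite inE; near: v.
exact: open_nbhs_nbhs.
Unshelve. all: by end_near. Qed.

Lemma smooth_on_partial (W : normedModType R) (D : set V) (f : V -> W) i :
  smooth_on D f -> smooth_on D (partial i f).
Proof. by move=> sf s u Du; have := sf (rcons s i) u Du; rewrite foldr_rcons. Qed.

Lemma smooth_on_diff (W : normedModType R) (D : set V) (f : V -> W) u :
  smooth_on D f -> D u -> differentiable f u.
Proof. by move=> /(_ [::]); apply. Qed.

Lemma smooth_onS (W : normedModType R) (D E : set V) (f : V -> W) :
  D `<=` E -> smooth_on E f -> smooth_on D f.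
Proof. by move=> DE sf s u Du; apply/sf/DE. Qed.

Lemma eq_smooth_on (W : normedModType R) (D : set V) (f g : V -> W) :
  open D -> {in D, f =1 g} -> smooth_on D f -> smooth_on D g.
Proof.
move=> oD fg sf.
apply: (@smooth_on_coind _ _ (fun h => exists2 k, smooth_on D k & {in D, h =1 k})) => //; last first.
  by exists f => // u uD; rewrite fg.
move=> h [k sk hk]; split=> [u Du|i].
  apply: (@near_eq_differentiable _ _ k); last exact: smooth_on_diff sk Du.
  by near=> v; apply/esym/hk; rewrite inE; near: v; exact: open_nbhs_nbhs.
exists (partial i k); last exact: eq_partial.
by exists (partial i k) => //; exact: smooth_on_partial.
Unshelve. all: by end_near. Qed.

Lemma row2E (v : V) : v = v 0 0 *: delta_mx 0 0 + v 0 1 *: delta_mx 0 1.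
Proof. by rewrite {1}(row_sum_delta v) !big_ord_recl big_ord0 addr0; congr (_ *: _ + v _ _ *: delta_mx _ _); apply/val_inj. Qed.

Lemma ord2_ind (P : 'I_2 -> Prop) : P 0 -> P 1 -> forall i, P i.
Proof.
move=> P0 P1 [[|[|//]] i2]; first by rewrite (_ : Ordinal i2 = 0) //; exact/val_inj.
by rewrite (_ : Ordinal i2 = 1) //; exact/val_inj.
Qed.

Definition vec2 (a b : R) : V := \row_j (if j == 0 then a else b).

Lemma vec2_0 a b : vec2 a b 0 0 = a. Proof. by rewrite mxE. Qed.
Lemma vec2_1 a b : vec2 a b 0 1 = b. Proof. by rewrite mxE. Qed.

Lemma vec2K (v : V) : vec2 (v 0 0) (v 0 1) = v.
Proof.
apply/rowP => j; rewrite mxE; case: eqP => [->//|/eqP j0]; congr (v _ _).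
by apply/val_inj; case: j j0 => -[|[|]].
Qed.

Lemma vec2E a b : vec2 a b = a *: delta_mx 0 0 + b *: delta_mx 0 1.
Proof. by rewrite [LHS]row2E vec2_0 vec2_1. Qed.

Lemma partial_diff (W : normedModType R) (f : V -> W) i u :
  differentiable f u -> partial i f u = 'd f u (delta_mx 0 i).
Proof. exact: deriveE. Qed.

Lemma diff_partial (W : normedModType R) (f : V -> W) u h :
  differentiable f u -> 'd f u h = h 0 0 *: partial 0 f u + h 0 1 *: partial 1 f u.
Proof. by move=> df; rewrite {1}(row2E h) linearD !linearZ !partial_diff. Qed.

Lemma differentiable_vec2 (a b : V -> R) u :
  differentiable a u -> differentiable b u ->
  differentiable (fun v => vec2 (a v) (b v)) u.
Proof.
move=> da db; rewrite (_ : (fun _ => _) =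
    (fun v => a v *: delta_mx 0 0) + (fun v => b v *: delta_mx 0 1)); last first.
  by apply/funext => v; rewrite vec2E.
by apply: differentiableD; apply: differentiableZl.
Qed.

Lemma partial_coord (n : nat) (f : V -> 'rV[R]_n) i j u : differentiable f u ->
  partial i (fun v => f v 0 j : R) u = partial i f u 0 j.
Proof.
move=> df; rewrite /partial derive_mx ?mxE //; exact: diff_derivable.
Qed.

Lemma partial_vec2 (a b : V -> R) i u :
  differentiable a u -> differentiable b u ->
  partial i (fun v => vec2 (a v) (b v)) u = vec2 (partial i a u) (partial i b u).
Proof.
move=> da db; have dv := differentiable_vec2 da db.
rewrite -[LHS]vec2K -!partial_coord //.
by congr (vec2 (partial i _ _) (partial i _ _)); apply/funext => v; rewrite mxE.
Qed.

Lemma partial_comp (W : normedModType R) (g : V -> W) (f : V -> V) i u :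
  differentiable f u -> differentiable g (f u) ->
  partial i (g \o f) u =
    partial i f u 0 0 *: partial 0 g (f u) + partial i f u 0 1 *: partial 1 g (f u).
Proof.
move=> df dg; have dgf := differentiable_comp df dg.
by rewrite partial_diff // diff_comp //= diff_partial // (partial_diff i df).
Qed.

Lemma partial_comp2 (W : normedModType R) (g : V -> W) (a b : V -> R) i u :
  differentiable a u -> differentiable b u -> differentiable g (vec2 (a u) (b u)) ->
  partial i (fun v => g (vec2 (a v) (b v))) u =
    partial i a u *: partial 0 g (vec2 (a u) (b u)) +
    partial i b u *: partial 1 g (vec2 (a u) (b u)).
Proof.
move=> da db dg; have dv := differentiable_vec2 da db.
have -> : (fun v => g (vec2 (a v) (b v))) = g \o (fun v => vec2 (a v) (b v)) by [].
by rewrite partial_comp // partial_vec2 // vec2_0 vec2_1.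
Qed.

Section rules.
Variables (i : 'I_2) (u : V).
Implicit Types f g : V -> R.

Lemma partial_cst (c : R) : partial i (fun=> c) u = 0.
Proof. exact: derive_cst. Qed.

Lemma partialD f g : differentiable f u -> differentiable g u ->
  partial i (fun v => f v + g v) u = partial i f u + partial i g u.
Proof. by move=> df dg; rewrite /partial [LHS](@deriveD _ _ _ f g) //; exact: diff_derivable. Qed.

Lemma partialM f g : differentiable f u -> differentiable g u ->
  partial i (fun v => f v * g v) u = partial i f u * g u + f u * partial i g u.
Proof.
move=> df dg; rewrite /partial [LHS](@deriveM _ _ f g) //; try exact: diff_derivable.
by rewrite addrC /GRing.scale /= mulrC.
Qed.

Lemma partialV f : differentiable f u -> f u != 0 ->
  partial i (fun v => (f v)^-1) u = - ((f u)^-1 * (f u)^-1 * partial i f u).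
Proof.
move=> df f0; rewrite /partial [LHS](@deriveV _ _ f) //; last exact: diff_derivable.
by rewrite /GRing.scale /= mulNr -expr2 exprVn.
Qed.

Lemma partialZ (c : R) f : differentiable f u ->
  partial i (fun v => c * f v) u = c * partial i f u.
Proof.
by move=> df; rewrite partialM ?partial_cst ?mul0r ?add0r //; exact: differentiable_cst.
Qed.
End rules.

Lemma partial_coord_id i j u : partial i (fun v : V => v 0 j : R) u = (i == j)%:R.
Proof.
rewrite partial_coord; last exact: (@ex_diff _ _ _ _ _ _ _ (is_diff_id u)).
by rewrite /partial derive_id mxE eqxx eq_sym.
Qed.

Section closure.
Variable D : set V.
Hypothesis oD : open D.

(** A class of expressions whose partial derivatives are computed constructor by constructor and
    stay in the class. In [SmoothComp] the outer function keeps its own domain [E], because the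
    chain rule replaces it by its partial derivatives, which are smooth on the same [E]. *)
Inductive smooth_alg : (V -> R) -> Prop :=
| SmoothBase f : smooth_on D f -> smooth_alg f
| SmoothCst c : smooth_alg (fun=> c)
| SmoothCoord j : smooth_alg (fun v => v 0 j)
| SmoothAdd f g : smooth_alg f -> smooth_alg g -> smooth_alg (fun u => f u + g u)
| SmoothMul f g : smooth_alg f -> smooth_alg g -> smooth_alg (fun u => f u * g u)
| SmoothInv f : smooth_alg f -> (forall u, D u -> f u != 0) ->
    smooth_alg (fun u => (f u)^-1)
| SmoothComp E g a b : smooth_on E g -> smooth_alg a -> smooth_alg b ->
    (forall u, D u -> E (vec2 (a u) (b u))) ->
    smooth_alg (fun u => g (vec2 (a u) (b u))).

Lemma smooth_alg_diff f : smooth_alg f -> forall u, D u -> differentiable f u.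
Proof.
elim=> {f} [f sf|c|j|f g _ df _ dg|f g _ df _ dg|f _ df f0|E g a b sg _ da _ db ab] u Du.
- exact: smooth_on_diff sf Du.
- exact: differentiable_cst.
- exact: differentiable_coord.
- by apply: differentiableD; [exact: df|exact: dg].
- by apply: differentiableM; [exact: df|exact: dg].
- by apply: differentiableV; [exact: df|exact: f0].
- apply: (@differentiable_comp _ _ _ _ (fun v => vec2 (a v) (b v)) g).
    by apply: differentiable_vec2; [exact: da|exact: db].
  by apply: smooth_on_diff sg _; exact: ab.
Qed.

Lemma smooth_algP f : smooth_alg f -> smooth_on D f.
Proof.
apply: smooth_on_coind => // {}f sf; split; first exact: smooth_alg_diff.
move=> i; elim: sf => {f} [f sf|c|j|f g sf [f' sf' ff'] sg [g' sg' gg']|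
   f g sf [f' sf' ff'] sg [g' sg' gg']|f sf [f' sf' ff'] f0|
   E g a b sg sa [a' sa' aa'] sb [b' sb' bb'] ab].
- by exists (partial i f) => //; exact/SmoothBase/smooth_on_partial.
- by exists (fun=> 0) => [|u _]; [exact: SmoothCst|rewrite partial_cst].
- by exists (fun=> (i == j)%:R) => [|u _]; [exact: SmoothCst|rewrite partial_coord_id].
- exists (fun u => f' u + g' u); first exact: SmoothAdd.
  move=> u /[dup] /set_mem Du uD.
  by rewrite partialD ?ff' ?gg' //; apply: smooth_alg_diff.
- exists (fun u => f' u * g u + f u * g' u).
    by apply: SmoothAdd; exact: SmoothMul.
  move=> u /[dup] /set_mem Du uD.
  by rewrite partialM ?ff' ?gg' //; apply: smooth_alg_diff.
- exists (fun u => -1 * (((f u)^-1 * (f u)^-1) * f' u)).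
    have sfV := SmoothInv sf f0.
    exact: (SmoothMul (SmoothCst _) (SmoothMul (SmoothMul sfV sfV) sf')).
  move=> u /[dup] /set_mem Du uD.
  by rewrite mulN1r partialV ?ff' //; [apply: smooth_alg_diff|exact: f0].
- exists (fun u => a' u * partial 0 g (vec2 (a u) (b u)) +
                   b' u * partial 1 g (vec2 (a u) (b u))).
    by apply: SmoothAdd; apply: SmoothMul => //;
      apply: (SmoothComp (E := E)) => //; exact: smooth_on_partial.
  move=> u /[dup] /set_mem Du uD.
  rewrite partial_comp2 ?aa' ?bb' //; try exact: smooth_alg_diff.
  by apply: smooth_on_diff sg _; exact: ab.
Qed.
End closure.
End smooth_calculus.

(** * Mean value estimates and the symmetry of mixed partial derivatives *)

Section mvt.
Context {R : realType}.
Notation V := 'rV[R]_2.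

Lemma is_derive_line (f : V -> R) (v w : V) (t : R) :
  differentiable f (v + t *: w) ->
  is_derive t 1 (fun s : R => f (v + s *: w))
    (w 0 0 * partial 0 f (v + t *: w) + w 0 1 * partial 1 f (v + t *: w)).
Proof.
move=> df.
have E : (fun h : R => h^-1 *: (f (v + (h *: 1 + t) *: w) - f (v + t *: w))) =
         (fun h : R => h^-1 *: (f (h *: w + (v + t *: w)) - f (v + t *: w))).
  by apply/funext => h; rewrite -[h *: 1]/(h * 1) mulr1 scalerDl addrCA.
have dw : derivable f (v + t *: w) w by exact: diff_derivable.
apply: DeriveDef; first by rewrite /derivable /= E.
rewrite /derive /= E -[LHS]/('D_w f (v + t *: w)) deriveE // diff_partial //.
Qed.

Lemma mvt_line (f : V -> R) (v w : V) :
  (forall t : R, 0 <= t <= 1 -> differentiable f (v + t *: w)) ->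
  exists2 c : R, 0 < c < 1 & f (v + w) - f v =
    w 0 0 * partial 0 f (v + c *: w) + w 0 1 * partial 1 f (v + c *: w).
Proof.
move=> df.
have dl (t : R) : 0 <= t <= 1 -> is_derive t 1 (fun s : R => f (v + s *: w))
    (w 0 0 * partial 0 f (v + t *: w) + w 0 1 * partial 1 f (v + t *: w)).
  by move=> /df; exact: is_derive_line.
have [c c01 E] := @MVT R (fun s : R => f (v + s *: w)) (fun t =>
    (w 0 0 * partial 0 f (v + t *: w) + w 0 1 * partial 1 f (v + t *: w))) 0 1 ltr01
  (fun t t01 => dl t (ltac:(by move: t01; rewrite in_itv /= => /andP[/ltW -> /ltW ->])))
  (ltac:(apply: derivable_within_continuous => t; rewrite in_itv /= => /dl [] //)).
exists c; first by move: c01; rewrite in_itv.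
by move: E; rewrite scale1r scale0r addr0 subr0 mulr1.
Qed.

Lemma ball_segment (W : normedModType R) (u v w : W) (r t : R) :
  0 <= t <= 1 -> ball u r v -> ball u r (v + w) -> ball u r (v + t *: w).
Proof.
move=> /andP[t0 t1]; rewrite -!ball_normE /ball_ /= => bv bw.
have -> : u - (v + t *: w) = (1 - t) *: (u - v) + t *: (u - (v + w)).
  rewrite scalerBl scale1r -addrA -scalerN -scalerDr opprB !opprD !addrA subrK.
  by rewrite subrr add0r scalerN.
apply: le_lt_trans (ler_normD _ _) _; rewrite !normrZ ger0_norm ?subr_ge0 // ger0_norm //.
(* Strictness comes from the second summand, which needs t > 0. *)
have [->|tn0] := eqVneq t 0; first by rewrite mul0r addr0 subr0 mul1r.
have -> : r = (1 - t) * r + t * r by rewrite -mulrDl subrK mul1r.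
by apply: ler_ltD; [rewrite ler_wpM2l ?subr_ge0// ltW|rewrite ltr_pM2l// lt_def tn0].
Qed.

Lemma norm_delta_le1 (i : 'I_2) : `|delta_mx 0 i : V| <= 1.
Proof.
rewrite /Num.Def.normr /= mx_normrE; apply: bigmax_le => // -[j k] _ /=.
by rewrite mxE; case: (_ && _); rewrite ?normr1 ?normr0.
Qed.

Lemma coord_le_norm (v : V) j : `|v 0 j| <= `|v|.
Proof.
rewrite [leRHS]/Num.Def.normr /= mx_normrE.
exact: (le_bigmax _ (fun ij : 'I_1 * 'I_2 => `|v ij.1 ij.2|) (0, j)).
Qed.

Lemma norm_le_coord (v : V) (r : R) : 0 <= r ->
  `|v 0 0| <= r -> `|v 0 1| <= r -> `|v| <= r.
Proof.
move=> r0 v0 v1; rewrite [leLHS]/Num.Def.normr /= mx_normrE.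
apply: bigmax_le => // -[i j] _ /=; rewrite (ord1 i).
by elim/ord2_ind: j.
Qed.

(** The factor 2 counts the coordinates: in the sup norm each coordinate of [w - v] is at most the
    norm. *)
Lemma lipschitz_ball (f : V -> R) (u : V) (r K : R) :
  (forall v, ball u r v -> differentiable f v) ->
  (forall v i, ball u r v -> `|partial i f v| <= K) ->
  forall v w, ball u r v -> ball u r w -> `|f w - f v| <= 2 * K * `|w - v|.
Proof.
move=> df fK v w bv bw.
have bs t : 0 <= t <= 1 -> ball u r (v + t *: (w - v)).
  by move=> t01; apply: ball_segment => //; rewrite addrC subrK.
have [t /bs/df//|c /andP[c0 c1]] := @mvt_line f v (w - v).
have {}bs : ball u r (v + c *: (w - v)) by apply: bs; rewrite !ltW.
rewrite [v + (w - v)]addrC subrK => ->.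
apply: le_trans (ler_normD _ _) _; rewrite !normrM.
have K0 : 0 <= K by apply: le_trans (fK v 0 bv).
rewrite mulrC -mulrA mulrDl mul1r mulrC; apply: lerD; rewrite mulrC; apply: ler_pM => //;
  by [exact: fK|exact: coord_le_norm].
Qed.

Lemma constant_on_ball (f : V -> R) (u : V) (r : R) :
  (forall v, ball u r v -> differentiable f v) ->
  (forall v i, ball u r v -> partial i f v = 0) ->
  forall v w, ball u r v -> ball u r w -> f w = f v.
Proof.
move=> df f0 v w bv bw; apply/eqP; rewrite -subr_eq0 -normr_le0.
have -> : 0 = 2 * 0 * `|w - v| by rewrite mulr0 mul0r.
by apply: lipschitz_ball bv bw => // x i /(f0 _ i) ->; rewrite normr0.
Qed.

Lemma partialE_delta (f : V -> R) (t : R) (i : 'I_2) u :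
  (t *: delta_mx 0 i : V) 0 0 * partial 0 f u +
  (t *: delta_mx 0 i : V) 0 1 * partial 1 f u = t * partial i f u.
Proof.
elim/ord2_ind: i; rewrite !mxE /=.
  by rewrite mulr1 mulr0 mul0r addr0.
by rewrite mulr1 mulr0 mul0r add0r.
Qed.

(** The mean value theorem is applied in direction [i] to the increment of [f] along
    [h *: delta_mx 0 j], then in direction [j] to [partial i f]. The left side of the equation is
    symmetric in [i] and [j] while the right side is not, which is what [partial_partialC]
    exploits. *)
Lemma second_difference (f : V -> R) (u : V) (r h : R) (i j : 'I_2) :
  (forall v, ball u r v -> differentiable f v) ->
  (forall v, ball u r v -> differentiable (partial i f) v) ->
  0 < h -> 2 * h < r ->
  exists2 v : V, `|v - u| <= 2 * h &
    f (u + h *: delta_mx 0 i + h *: delta_mx 0 j) - f (u + h *: delta_mx 0 i)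
    - f (u + h *: delta_mx 0 j) + f u = h ^+ 2 * partial j (partial i f) v.
Proof.
move=> df dif h0 hr; set a := h *: delta_mx 0 i; set b := h *: delta_mx 0 j.
have nb (s t : R) : 0 <= s <= 1 -> 0 <= t <= 1 -> `|s *: a + t *: b| <= 2 * h.
  move=> /andP[s0 s1] /andP[t0 t1]; rewrite /a /b !scalerA.
  apply: le_trans (ler_normD _ _) _; rewrite !normrZ mulr2n mulrDl !mul1r.
  have H (x : R) k : 0 <= x -> x <= 1 -> `|x| * `|h| * `|delta_mx 0 k : V| <= h.
    move=> x0 x1; rewrite (ger0_norm x0) (ger0_norm (ltW h0)).
    apply: (@le_trans _ _ (x * h * 1)).
      by rewrite ler_wpM2l ?mulr_ge0 ?(ltW h0)// norm_delta_le1.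
    by rewrite mulr1 ler_piMl// ltW.
  by apply: lerD; apply: H.
have bu (s t : R) : 0 <= s <= 1 -> 0 <= t <= 1 -> ball u r (u + (s *: a + t *: b)).
  move=> s01 t01; rewrite -ball_normE /ball_ /= opprD addrA subrr add0r normrN.
  exact: le_lt_trans (nb _ _ s01 t01) hr.
have z01 : 0 <= (0 : R) <= 1 by rewrite lexx ler01.
have o01 : 0 <= (1 : R) <= 1 by rewrite lexx ler01.
pose g (s : R) : R := f (u + b + s *: a) - f (u + s *: a).
pose dg (s : R) : R := h * partial i f (u + b + s *: a) - h * partial i f (u + s *: a).
have eb s : u + b + s *: a = u + (s *: a + 1 *: b) by rewrite scale1r -addrA [b + _]addrC.
have e0 s : u + s *: a = u + (s *: a + 0 *: b) by rewrite scale0r addr0.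
have dgP (s : R) : 0 <= s <= 1 -> is_derive s 1 g (dg s).
  move=> s01; rewrite /g /dg -(partialE_delta f h i (u + b + s *: a)) -(partialE_delta f h i (u + s *: a)).
  apply: is_deriveB; apply: is_derive_line; apply: df; rewrite -/a.
    by rewrite eb; exact: bu.
  by rewrite e0; exact: bu.
have [c c01 E] := @MVT R g dg 0 1 ltr01
  (fun t t01 => dgP t (ltac:(by move: t01; rewrite in_itv /= => /andP[/ltW -> /ltW ->])))
  (ltac:(apply: derivable_within_continuous => t; rewrite in_itv /= => /dgP [] //)).
have {}c01 : 0 <= c <= 1.
  by move: c01; rewrite in_itv /= => /andP[/ltW -> /ltW ->].
have [t t01|d /andP[/ltW d0 /ltW d1]] := @mvt_line (partial i f) (u + c *: a) b.
  by apply: dif; rewrite -addrA; exact: bu.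
rewrite partialE_delta => E2.
exists (u + c *: a + d *: b).
  rewrite -[_ + _ + d *: b]addrA addrAC subrr add0r.
  by apply: nb => //; rewrite d0.
move: E; rewrite /g /dg -mulrBr subr0 mulr1 !scale1r !scale0r !addr0.
rewrite (_ : u + b + c *: a = u + c *: a + b); last by rewrite addrAC.
rewrite E2 mulrA -expr2 => <-.
rewrite (_ : u + b + a = u + a + b); last by rewrite addrAC.
by ring.
Qed.

Lemma eq_at_limit (p q : V -> R) (u : V) :
  {for u, continuous p} -> {for u, continuous q} ->
  (forall m : R, 0 < m -> exists2 v, ball u m v & exists2 w, ball u m w & p v = q w) ->
  p u = q u.
Proof.
move=> cp cq pq.
apply/eqP; rewrite -subr_eq0 -normr_le0; apply/ler_addgt0Pl => e e0; rewrite addr0.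
have e20 : 0 < e / 2 by rewrite divr_gt0.
have [d1 /= d10 d1P] := (nbhs_ballP _ _).1 ((cvgrPdist_lt _ _).1 cp _ e20).
have [d2 /= d20 d2P] := (nbhs_ballP _ _).1 ((cvgrPdist_lt _ _).1 cq _ e20).
have [|v bv [w bw E]] := pq (Num.min d1 d2); first by rewrite lt_min d10.
have m1 : Num.min d1 d2 <= d1 by rewrite ge_min lexx.
have m2 : Num.min d1 d2 <= d2 by rewrite ge_min lexx orbT.
have := d1P v (le_ball m1 bv); have := d2P w (le_ball m2 bw).
rewrite /= ler_distl !ltr_distl E; clear.
by move: (p u) (q u) (q w) => a b c; lra.
Qed.

(** One second difference equals h^2 times each of the two mixed derivatives, taken at two different
    points near [u]; continuity at [u] identifies their limits. *)
Lemma partial_partialC (D : set V) (f : V -> R) (i j : 'I_2) u :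
  open D -> smooth_on D f -> D u ->
  partial i (partial j f) u = partial j (partial i f) u.
Proof.
move=> oD sf Du.
have [r /= r0 rD] : exists2 r : R, 0 < r & ball u r `<=` D.
  by apply/nbhs_ballP; exact: open_nbhs_nbhs.
have df k v : ball u r v -> differentiable (partial k f) v.
  by move=> /rD; apply: smooth_on_diff; exact: smooth_on_partial.
have df0 v : ball u r v -> differentiable f v.
  by move=> /rD; apply: smooth_on_diff.
have cvg2 k l : {for u, continuous (partial k (partial l f))}.
  apply: differentiable_continuous; apply: smooth_on_diff Du.
  by do 2 apply: smooth_on_partial.
apply: eq_at_limit => // d d0.
pose m : R := Num.min r d.
have m0 : 0 < m by rewrite !lt_min r0 d0.
(* With h = m / 3 the distance 2 h allowed to the intermediate points is below both [r] and [d]. *)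
have h0 : 0 < m / 3 by rewrite divr_gt0.
have hm : 2 * (m / 3) < m by move: m0; clearbody m; lra.
have mr : 2 * (m / 3) < r by apply: lt_le_trans hm _; rewrite ge_min lexx.
have md : 2 * (m / 3) < d by apply: lt_le_trans hm _; rewrite ge_min lexx orbT.
have [v vu E] := second_difference i df0 (df j) h0 mr.
have [w wu] := second_difference j df0 (df i) h0 mr.
rewrite (addrAC u) (addrAC (f _) (- f _) (- f _)) {}E => /mulfI E.
exists v; first by rewrite -ball_normE /ball_ /= distrC (le_lt_trans vu).
exists w; first by rewrite -ball_normE /ball_ /= distrC (le_lt_trans wu).
by apply: E; rewrite sqrf_eq0 gt_eqF.
Qed.
End mvt.

(** * Inverse function theorem in the plane *)

Section inverse_function.
Context {R : realType}.
Notation V := 'rV[R]_2.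

Definition jac (a b : V -> R) (u : V) : R :=
  partial 0 a u * partial 1 b u - partial 1 a u * partial 0 b u.

(** The preimage of [w] under the matrix [[p, q; r, t]]. *)
Definition cramer (p q r t : R) (w : V) : V :=
  vec2 ((t * w 0 0 - q * w 0 1) / (p * t - q * r))
       ((p * w 0 1 - r * w 0 0) / (p * t - q * r)).

Section cramer.
Variables p q r t : R.

Lemma cramer_linear : linear (cramer p q r t).
Proof.
move=> k x y; rewrite /cramer [X in _ = k *: X + _]vec2E [X in _ = _ + X]vec2E vec2E.
rewrite scalerDr !scalerA addrACA -!scalerDl !mxE; congr (_ *: _ + _ *: _); ring.
Qed.

Lemma cramer_differentiable u : differentiable (cramer p q r t) u.
Proof.
by apply: differentiable_vec2; apply: differentiableM => //;
   apply: differentiableB; apply: differentiableM => //; exact: differentiable_coord.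
Qed.

Definition cramer_lin : {linear V -> V} :=
  HB.pack (cramer p q r t) (GRing.isLinear.Build R V V _ _ cramer_linear).

Lemma cramerB v w : cramer p q r t (v - w) = cramer p q r t v - cramer p q r t w.
Proof. exact: (linearB cramer_lin). Qed.

Lemma cramer_bound (w : V) :
  `|cramer p q r t w| <= (`|p| + `|q| + `|r| + `|t|) / `|p * t - q * r| * `|w|.
Proof.
have H (x y : R) : `|x| + `|y| <= `|p| + `|q| + `|r| + `|t| ->
    `|(x * w 0 0 - y * w 0 1) / (p * t - q * r)| <=
      (`|p| + `|q| + `|r| + `|t|) / `|p * t - q * r| * `|w|.
  move=> xy; rewrite normrM normfV mulrAC ler_wpM2r ?invr_ge0 //.
  apply: le_trans (ler_normB _ _) _; rewrite !normrM.
  apply: (@le_trans _ _ ((`|x| + `|y|) * `|w|)); last by rewrite ler_wpM2r.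
  by rewrite mulrDl lerD// ler_wpM2l// coord_le_norm.
apply: norm_le_coord; rewrite ?vec2_0 ?vec2_1; first by rewrite !mulr_ge0 ?invr_ge0 ?addr_ge0.
  by apply: H; have := normr_ge0 p; have := normr_ge0 r; lra.
have -> : p * w 0 1 - r * w 0 0 = (- r) * w 0 0 - (- p) * w 0 1 by ring.
by apply: H; rewrite !normrN; have := normr_ge0 q; have := normr_ge0 t; lra.
Qed.

Lemma cramer_inj : p * t - q * r != 0 -> injective (cramer p q r t).
Proof.
move=> d0 w w' E.
have E0 : cramer p q r t w 0 0 = cramer p q r t w' 0 0 by rewrite E.
have E1 : cramer p q r t w 0 1 = cramer p q r t w' 0 1 by rewrite E.
move: E0 E1; rewrite !vec2_0 !vec2_1 => /(divIf d0) E0 /(divIf d0) E1.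
rewrite -(vec2K w) -(vec2K w'); congr vec2; apply: (mulfI d0).
  have -> : (p * t - q * r) * w 0 0 =
    p * (t * w 0 0 - q * w 0 1) + q * (p * w 0 1 - r * w 0 0) by ring.
  by rewrite E0 E1; ring.
have -> : (p * t - q * r) * w 0 1 =
  r * (t * w 0 0 - q * w 0 1) + t * (p * w 0 1 - r * w 0 0) by ring.
by rewrite E0 E1; ring.
Qed.
End cramer.

Variables (D : set V) (a b : V -> R) (u0 : V).
Hypotheses (oD : open D) (Du0 : D u0) (sa : smooth_on D a) (sb : smooth_on D b).
Hypothesis jac0 : jac a b u0 != 0.

Let phi (u : V) : V := vec2 (a u) (b u).
Let L (u : V) : V -> V :=
  cramer (partial 0 a u) (partial 1 a u) (partial 0 b u) (partial 1 b u).

Lemma near_partial (f : V -> R) i (e : R) : smooth_on D f -> 0 < e ->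
  \forall u \near u0, `|partial i f u - partial i f u0| < e.
Proof.
move=> sf e0.
have := differentiable_continuous (smooth_on_diff (smooth_on_partial i sf) Du0).
by move=> /cvgrPdist_lt/(_ _ e0); apply: filterS => u; rewrite distrC.
Qed.

Lemma smooth_jac : smooth_on D (jac a b).
Proof.
apply: smooth_algP => //.
have H (f : V -> R) i : smooth_on D f -> smooth_alg D (partial i f).
  by move=> sf; exact/SmoothBase/smooth_on_partial.
rewrite (_ : jac a b = (fun u => partial 0 a u * partial 1 b u +
   -1 * (partial 1 a u * partial 0 b u))); last by apply/funext => u; rewrite mulN1r.
apply: SmoothAdd; first by apply: SmoothMul; exact: H.
by apply: SmoothMul; [exact: SmoothCst|apply: SmoothMul; exact: H].
Qed.

Lemma near_contraction_coef (p q r t : R) :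
  partial 0 a u0 = p -> partial 1 a u0 = q ->
  partial 0 b u0 = r -> partial 1 b u0 = t -> p * t - q * r != 0 ->
  exists2 s : R, 0 < s &
  [/\ ball u0 s `<=` D, (forall u, ball u0 s u -> jac a b u != 0) &
      forall u v, ball u0 s u -> ball u0 s v ->
        `|u - v - (cramer p q r t (phi u) - cramer p q r t (phi v))| <= 2^-1 * `|u - v|].
Proof.
move=> pE qE rE tE d0.
pose N : R := (`|p| + `|q| + `|r| + `|t|) / `|p * t - q * r|.
have N0 : 0 <= N by rewrite !mulr_ge0 ?invr_ge0 ?addr_ge0.
(* Each partial derivative of a coordinate of [v - L u0 (phi v)] is then at most N e <= 1 / 4, and
   [lipschitz_ball] doubles this to 1 / 2. *)
pose e : R := (4 * (N + 1))^-1.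
have e0 : 0 < e by rewrite invr_gt0 mulr_gt0 // ltr_wpDl.
have : \forall u \near u0, [/\ D u, jac a b u != 0,
    forall i, `|partial i a u - partial i a u0| < e &
    forall i, `|partial i b u - partial i b u0| < e].
  have nD : \forall u \near u0, D u by exact: open_nbhs_nbhs.
  have nJ : \forall u \near u0, jac a b u != 0.
    have := differentiable_continuous (smooth_on_diff smooth_jac Du0).
    by move=> /cvgr_neq0; apply.
  have na : \forall u \near u0, forall i, `|partial i a u - partial i a u0| < e.
    apply: (@filter_forall _ _ (fun i u => `|partial i a u - partial i a u0| < e) (nbhs u0)) => i.
    exact: (near_partial i sa e0).
  have nb : \forall u \near u0, forall i, `|partial i b u - partial i b u0| < e.
    apply: (@filter_forall _ _ (fun i u => `|partial i b u - partial i b u0| < e) (nbhs u0)) => i.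
    exact: (near_partial i sb e0).
  apply: filterS2 (filterI nD nJ) (filterI na nb).
  by move=> u [? ?] [? ?]; split.
move=> /nbhs_ballP[s /= s0 sP]; exists s => //; split.
- by move=> u /sP[].
- by move=> u /sP[].
move=> u v bu bv.
(* [c1] and [c2] will be a row of minus the inverse matrix; the two equations say that the partial
   derivatives of u_j + c1 a + c2 b vanish at [u0]. *)
have key (j : 'I_2) (c1 c2 : R) : `|c1| + `|c2| <= N ->
    (0 == j)%:R + (c1 * p + c2 * r) = 0 -> (1 == j)%:R + (c1 * q + c2 * t) = 0 ->
    `|(u 0 j + (c1 * a u + c2 * b u)) - (v 0 j + (c1 * a v + c2 * b v))| <= 2^-1 * `|u - v|.
  have alg (d x y x0 y0 : R) : d + (c1 * x0 + c2 * y0) = 0 ->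
      d + (c1 * x + c2 * y) = c1 * (x - x0) + c2 * (y - y0).
    by move=> /eqP; rewrite addr_eq0 => /eqP ->; ring.
  rewrite -pE -qE -rE -tE => cN c0 c1'.
  have {c1'}c0 i : (i == j)%:R + (c1 * partial i a u0 + c2 * partial i b u0) = 0.
    elim/ord2_ind: i; [exact: c0|exact: c1'].
  have -> : (2^-1 : R) = 2 * 4^-1 by rewrite (natrM _ 2 2) invfM mulrA divff ?mul1r // pnatr_eq0.
  apply: (@lipschitz_ball _ (fun w => w 0 j + (c1 * a w + c2 * b w)) u0 s) => //.
    move=> w /sP[Dw _ _ _]; apply: differentiableD; first exact: differentiable_coord.
    apply: differentiableD; apply: differentiableM => //; exact: smooth_on_diff Dw.
  move=> w i /sP[Dw _ aw bw].
  have da := smooth_on_diff sa Dw; have db := smooth_on_diff sb Dw.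
  have dca : differentiable (fun w => c1 * a w) w by exact: differentiableM.
  have dcb : differentiable (fun w => c2 * b w) w by exact: differentiableM.
  rewrite partialD; [|exact: differentiable_coord|exact: differentiableD].
  rewrite partialD // !partialZ // partial_coord_id.
  rewrite (alg _ _ _ _ _ (c0 i)).
  apply: le_trans (ler_normD _ _) _; rewrite !normrM.
  apply: (@le_trans _ _ (N * e)).
    apply: (@le_trans _ _ ((`|c1| + `|c2|) * e)); last by rewrite ler_wpM2r // ltW.
    by rewrite mulrDl lerD// ler_wpM2l// ltW.
  rewrite /e invfM mulrCA ler_piMr ?invr_ge0 // ler_pdivrMr ?mul1r ?lerDl //.
  by rewrite ltr_wpDl.
have split_le (x y : R) : `|x| + `|y| <= `|p| + `|q| + `|r| + `|t| ->
    `|x / (p * t - q * r)| + `|y / (p * t - q * r)| <= N.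
  by move=> xy; rewrite !normrM !normfV -mulrDl ler_wpM2r ?invr_ge0.
have n0 := normr_ge0 p; have n1 := normr_ge0 q.
have n2 := normr_ge0 r; have n3 := normr_ge0 t.
apply: norm_le_coord; first by rewrite mulr_ge0 ?invr_ge0.
  have := key 0 (- t / (p * t - q * r)) (q / (p * t - q * r)).
  rewrite [X in _ -> _ -> _ -> `|X| <= _](_ : _ =
    (u - v - (cramer p q r t (phi u) - cramer p q r t (phi v))) 0 0).
    apply; first by apply: split_le; rewrite normrN; lra.
      by rewrite eqxx /=; field.
    by rewrite /=; field.
  by rewrite /phi !mxE /=; move: (u 0 0) (v 0 0) (a u) (b u) (a v) (b v) => *; field.
have := key 1 (r / (p * t - q * r)) (- p / (p * t - q * r)).
rewrite [X in _ -> _ -> _ -> `|X| <= _](_ : _ =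
  (u - v - (cramer p q r t (phi u) - cramer p q r t (phi v))) 0 1).
  apply; first by apply: split_le; rewrite normrN; lra.
    by rewrite /=; field.
  by rewrite eqxx /=; field.
by rewrite /phi !mxE /=; move: (u 0 1) (v 0 1) (a u) (b u) (a v) (b v) => *; field.
Qed.

(* [v |-> v - L u0 (phi v)] has zero derivative at [u0]. *)
Lemma near_contraction : exists2 s : R, 0 < s &
  [/\ ball u0 s `<=` D, (forall u, ball u0 s u -> jac a b u != 0) &
      forall u v, ball u0 s u -> ball u0 s v ->
        `|u - v - (L u0 (phi u) - L u0 (phi v))| <= 2^-1 * `|u - v|].
Proof. exact: near_contraction_coef. Qed.

(** [T] is the Newton map with the derivative frozen at [u0]. It contracts by 1 / 2 and moves [u0]
    by less than s / 4, so it sends the closed ball of radius s / 2 into the open one. At its fixed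
    point [L u0 (phi u) = L u0 v], and [L u0] is injective. *)
Lemma contraction_solve (s : R) (v : V) : 0 < s ->
  (forall u w, ball u0 s u -> ball u0 s w ->
     `|u - w - (L u0 (phi u) - L u0 (phi w))| <= 2^-1 * `|u - w|) ->
  `|L u0 v - L u0 (phi u0)| < s / 4 ->
  exists2 u, ball u0 (s / 2) u & phi u = v.
Proof.
move=> s0 ctr vs.
have s20 : 0 < s / 2 by rewrite divr_gt0.
have s2s : s / 2 < s by lra.
pose U := closed_ball u0 (s / 2).
have UE : U = [set u | `|u0 - u| <= s / 2] by rewrite /U closed_ballE.
pose T (u : V) : V := u - (L u0 (phi u) - L u0 v).
have bU u : U u -> ball u0 s u.
  by rewrite UE -ball_normE /= => /le_lt_trans; apply.
have TU u : U u -> `|u0 - T u| < s / 2.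
  move=> Uu; have := ctr _ _ (bU _ Uu) (ballxx u0 s0) => c.
  rewrite distrC (_ : T u - u0 = (u - u0 - (L u0 (phi u) - L u0 (phi u0))) +
     (L u0 v - L u0 (phi u0))); last first.
    rewrite /T; move: (L u0 (phi u)) (L u0 (phi u0)) (L u0 v) => x y z.
    by apply/rowP => k; rewrite !mxE; ring.
  apply: le_lt_trans (ler_normD _ _) _; have := Uu; rewrite UE /= distrC => uU.
  by move: c vs uU; set x := `|_|; set y := `|_|; set z := `|_|; lra.
have TF : {homo T : u / U u >-> U u}.
  by move=> u Uu; rewrite UE /= ltW // TU.
pose F : {fun U >-> U} := HB.pack T (isFun.Build _ _ U U T TF).
have FC : is_contraction F.
  exists (2^-1)%:nng; split => /=; first by rewrite invf_lt1 // ltr1n.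
  move=> [u w] [/= /bU bu /bU bw].
  rewrite (_ : T u - T w = u - w - (L u0 (phi u) - L u0 (phi w))) ?ctr //.
  rewrite /T; move: (L u0 (phi u)) (L u0 (phi w)) (L u0 v) => x y z.
  by apply/rowP => k; rewrite !mxE; ring.
pose X : completeNormedModType R := HB.pack V.
have [||u Uu uE] := @banach_fixed_point R X U F FC.
- exact: closed_ball_closed.
- by exists u0; rewrite UE /= subrr normr0 ltW.
exists u; first by rewrite -ball_normE /= uE; exact: TU.
have {uE} : L u0 (phi u) = L u0 v.
  apply/eqP; rewrite -subr_eq0 -oppr_eq0; apply/eqP.
  by apply: (addrI u); rewrite addr0 [in RHS]uE.
exact: cramer_inj.
Qed.

(* The local inverse is Lipschitz, so the first-order remainder of [phi] at [psi v]
   is also [o(h)] in the increment [h] of [v]. *)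
Lemma inverse_differentiable (psi : V -> V) (v : V) (C : R) :
  D (psi v) -> jac a b (psi v) != 0 -> 0 < C ->
  (\forall h \near (0 : V), phi (psi (h + v)) = h + v /\
     `|psi (h + v) - psi v| <= C * `|h|) ->
  differentiable psi v /\
  forall h, 'd psi v h = cramer (partial 0 a (psi v)) (partial 1 a (psi v))
    (partial 0 b (psi v)) (partial 1 b (psi v)) h.
Proof.
move=> Du J0 C0 psiP; set u := psi v in Du J0 psiP *.
move Ep : (partial 0 a u) => p; move Eq : (partial 1 a u) => q.
move Er : (partial 0 b u) => r; move Et : (partial 1 b u) => t.
have d0 : p * t - q * r != 0 by rewrite -Ep -Eq -Er -Et.
have da := smooth_on_diff sa Du; have db := smooth_on_diff sb Du.
have lc : continuous (cramer_lin p q r t).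
  by move=> w; apply: differentiable_continuous; exact: cramer_differentiable.
suff rem : forall e : R, 0 < e -> \forall h \near (0 : V),
    `|psi (h + v) - (psi v + cramer_lin p q r t h)| <= e * `|h|.
  by have [dpsi dE] := remainder_differentiable lc rem; split=> // h; rewrite dE.
move=> e e0.
pose N : R := `|p| + `|q| + `|r| + `|t|.
have N0 : 0 <= N by rewrite /N !addr_ge0.
(* Chosen so that N / |p t - q r| times e' C is at most e; N + 1 keeps the denominator positive. *)
pose e' : R := e * `|p * t - q * r| / ((N + 1) * C).
have e'0 : 0 < e' by rewrite !mulr_gt0 ?invr_gt0 ?normr_gt0 // mulr_gt0 // ltr_wpDl.
have rem (f : V -> R) (f0 f1 : R) : differentiable f u -> partial 0 f u = f0 ->
    partial 1 f u = f1 -> \forall k \near (0 : V),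
    `|f (k + u) - f u - (k 0 0 * f0 + k 0 1 * f1)| <= e' * `|k|.
  move=> df <- <-; apply: filterS (differentiable_remainder df e'0) => k.
  by rewrite diff_partial // opprD addrA.
have [d1 /= d10 d1P] := (nbhs_ballP _ _).1 (rem a p q da Ep Eq).
have [d2 /= d20 d2P] := (nbhs_ballP _ _).1 (rem b r t db Er Et).
pose d := Num.min d1 d2.
have dd0 : 0 < d by rewrite lt_min d10.
have nh : \forall h \near (0 : V), `|h| < d / C.
  apply/nbhs_ballP; exists (d / C); first by rewrite /= divr_gt0.
  by move=> h; rewrite -ball_normE /= sub0r normrN.
have phiu : phi u = v.
  by have := nbhs_singleton psiP; rewrite add0r => -[].
apply: filterS2 nh psiP => h hd [phih psih].
pose k := psi (h + v) - u.
have kd : `|k| < d.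
  by apply: le_lt_trans psih _; rewrite mulrC -ltr_pdivlMr.
have bk1 : ball 0 d1 k.
  by rewrite -ball_normE /= sub0r normrN (lt_le_trans kd)// ge_min lexx.
have bk2 : ball 0 d2 k.
  by rewrite -ball_normE /= sub0r normrN (lt_le_trans kd)// ge_min lexx orbT.
have ku : k + u = psi (h + v) by rewrite subrK.
have au : a u = v 0 0 by rewrite -phiu /phi vec2_0.
have bu : b u = v 0 1 by rewrite -phiu /phi vec2_1.
have ah : a (psi (h + v)) = h 0 0 + v 0 0.
  by have := congr1 (fun w : V => w 0 0) phih; rewrite /phi vec2_0 mxE.
have bh : b (psi (h + v)) = h 0 1 + v 0 1.
  by have := congr1 (fun w : V => w 0 1) phih; rewrite /phi vec2_1 mxE.
have := d2P _ bk2; have := d1P _ bk1.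
rewrite /= ku ah bh au bu !addrK.
set ra := h 0 0 - _; set rb := h 0 1 - _ => Ha Hb.
rewrite -/u opprD addrA -/k.
have -> : k - cramer_lin p q r t h = - cramer p q r t (vec2 ra rb).
  apply/rowP; apply: ord2_ind; rewrite /ra /rb !mxE /=;
    move: (k 0 0) (k 0 1) (h 0 0) (h 0 1) => k0 k1 h0 h1; by field.
rewrite normrN; apply: le_trans (cramer_bound _ _ _ _ _) _; rewrite -/N.
have rab : `|vec2 ra rb| <= e' * (C * `|h|).
  have ek : e' * `|k| <= e' * (C * `|h|) by rewrite ler_wpM2l // ltW.
  apply: norm_le_coord; rewrite ?vec2_0 ?vec2_1; last 2 first.
  - exact: le_trans Ha ek.
  - exact: le_trans Hb ek.
  by rewrite mulr_ge0 ?(ltW e'0) // mulr_ge0 // ltW.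
apply: le_trans (ler_wpM2l _ rab) _; first by rewrite mulr_ge0 ?invr_ge0.
rewrite /e'.
have -> : N / `|p * t - q * r| * (e * `|p * t - q * r| / ((N + 1) * C) * (C * `|h|)) =
    N / (N + 1) * (e * `|h|).
  by field; rewrite normr_eq0 d0 (gt_eqF C0) gt_eqF // ltr_wpDl.
rewrite ler_piMl ?mulr_ge0 ?(ltW e0) // ler_pdivrMr ?mul1r ?lerDl //.
by rewrite ltr_wpDl.
Qed.

(** The image is an exact ball, ready to be the range of a chart. Smoothness of [psi] is expressed
    through compositions because these are closed under differentiation: a partial derivative of
    [k \o psi] is again some [pk \o psi], where [pk] combines the partial derivatives of [k] with
    entries of the inverse Jacobian matrix. *)
Theorem inverse_function : exists (U : set V) (psi : V -> V) (r : R),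
  [/\ 0 < r, [/\ open U, U u0, U `<=` D & forall u, U u -> jac a b u != 0],
      forall u, U u -> ball (phi u0) r (phi u) /\ psi (phi u) = u,
      forall v, ball (phi u0) r v ->
        [/\ U (psi v), phi (psi v) = v & differentiable psi v] &
      forall h : V -> R, smooth_on U h -> smooth_on (ball (phi u0) r) (h \o psi)].
Proof.
have [s s0 [sD sJ ctr]] := near_contraction.
pose N : R := (`|partial 0 a u0| + `|partial 1 a u0| + `|partial 0 b u0| +
  `|partial 1 b u0|) / `|jac a b u0|.
have N0 : 0 <= N by rewrite !mulr_ge0 ?invr_ge0 ?addr_ge0.
have N10 : 0 < N + 1 by rewrite ltr_wpDl.
have LN w w' : `|L u0 w - L u0 w'| <= N * `|w - w'|.
  by rewrite /L -cramerB; exact: cramer_bound.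
(* By [LN], points within r of [phi u0] satisfy the bound s / 4 required by [contraction_solve]. *)
pose r : R := s / 4 / (N + 1).
have r0 : 0 < r by rewrite !divr_gt0.
have s2s : s / 2 < s by lra.
have bs u : ball u0 (s / 2) u -> ball u0 s u by apply: le_ball; exact: ltW.
(* The default [u0] is the value where no preimage exists; [psi] is only used on the ball, where one
   does. *)
pose psi (v : V) : V := xget u0 [set u | ball u0 (s / 2) u /\ phi u = v].
have psiP v : ball (phi u0) r v -> ball u0 (s / 2) (psi v) /\ phi (psi v) = v.
  move=> bv; apply: (@xgetPex _ u0 [set u | ball u0 (s / 2) u /\ phi u = v]).
  have [u] : exists2 u, ball u0 (s / 2) u & phi u = v; last by exists u.
  apply: contraction_solve => //; apply: le_lt_trans (LN _ _) _.
  move: bv; rewrite -ball_normE /= distrC ltr_pdivlMr // => bv.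
  apply: le_lt_trans bv; rewrite mulrC ler_wpM2l //.
  by rewrite lerDl.
have inj u w : ball u0 s u -> ball u0 s w ->
    `|u - w| <= 2 * `|L u0 (phi u) - L u0 (phi w)|.
  move=> bu bw; have := ctr _ _ bu bw.
  have := ler_distD (L u0 (phi u) - L u0 (phi w)) (u - w) 0; rewrite !subr0.
  by set x := `|_|; set y := `|_|; set z := `|_|; lra.
(* The image of the half ball need not be a ball; cutting with the preimage makes [phi] a bijection
   of [U] onto the ball of radius [r]. *)
pose U : set V := [set u | ball u0 (s / 2) u /\ ball (phi u0) r (phi u)].
have oU : open U.
  rewrite openE => u [bu bphi]; apply: filterI.
    by apply: open_nbhs_nbhs; split => //; exact: ball_open.
  have cphi : {for u, continuous phi}.
    apply: differentiable_continuous.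
    by apply: differentiable_vec2; [apply: smooth_on_diff sa _|apply: smooth_on_diff sb _];
       apply/sD/bs.
  by apply: cphi; apply: open_nbhs_nbhs; split => //; exact: ball_open.
have Uu0 : U u0 by split; apply: ballxx => //; rewrite divr_gt0.
have psiK u : U u -> psi (phi u) = u.
  move=> [bu bphi]; have [bp Ep] := psiP _ bphi.
  apply/eqP; rewrite -subr_eq0 -normr_le0.
  by have := inj _ _ (bs _ bp) (bs _ bu); rewrite Ep subrr normr0 mulr0.
have Upsi v : ball (phi u0) r v -> U (psi v).
  by move=> bv; have [bp Ep] := psiP _ bv; split => //; rewrite Ep.
have UD : U `<=` D by move=> u [/bs/sD].
have UJ u : U u -> jac a b u != 0 by move=> [/bs/sJ].
have dpsi v : ball (phi u0) r v -> differentiable psi v /\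
    forall h, 'd psi v h = cramer (partial 0 a (psi v)) (partial 1 a (psi v))
    (partial 0 b (psi v)) (partial 1 b (psi v)) h.
  (* [inj] and [LN] give the Lipschitz constant 2 N for [psi]; the extra 1 makes it positive. *)
  move=> bv; apply: (@inverse_differentiable psi v (2 * N + 1)).
  - exact/UD/Upsi.
  - exact/UJ/Upsi.
  - by rewrite ltr_wpDl // mulr_ge0.
  have : \forall h \near (0 : V), ball (phi u0) r (h + v).
    rewrite (near_shift v); near=> w; rewrite /= sub0r subrK; near: w.
    by apply: open_nbhs_nbhs; split => //; exact: ball_open.
  apply: filterS => h bh; have [bp Ep] := psiP _ bv; have [bp' Ep'] := psiP _ bh.
  split => //; apply: le_trans (inj _ _ (bs _ bp') (bs _ bp)) _.
  rewrite Ep Ep' (mulrDl (2 * N)) mul1r -(mulrA 2 N).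
  have := LN (h + v) v; rewrite addrK.
  have := normr_ge0 h; set x := `|_|; set y := `|_|; set z := N * _; lra.
exists U, psi, r; split => //.
- by move=> u Uu; split; [case: Uu|exact: psiK].
- by move=> v bv; split; [exact: Upsi|exact: (psiP _ bv).2|exact: (dpsi _ bv).1].
move=> h sh.
apply: (@smooth_on_coind _ _ _ (fun f => exists2 k, smooth_on U k & f = k \o psi)).
- exact: ball_open.
- move=> _ [k sk ->]; split.
    move=> v bv; apply: differentiable_comp; first exact: (dpsi _ bv).1.
    exact: smooth_on_diff sk (Upsi _ bv).
  move=> i.
  pose pk (v : V) : R := cramer (partial 0 a v) (partial 1 a v)
    (partial 0 b v) (partial 1 b v) (delta_mx 0 i) 0 0 * partial 0 k v +
    cramer (partial 0 a v) (partial 1 a v)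
    (partial 0 b v) (partial 1 b v) (delta_mx 0 i) 0 1 * partial 1 k v.
  exists (pk \o psi).
    exists pk => //; apply: smooth_algP => //.
    have H (f : V -> R) j : smooth_on D f -> smooth_alg U (partial j f).
      by move=> sf; apply/SmoothBase/(smooth_onS UD)/smooth_on_partial.
    have HJ : smooth_alg U (fun v => (jac a b v)^-1).
      by apply: SmoothInv => //; apply/SmoothBase/(smooth_onS UD)/smooth_jac.
    have Hk j : smooth_alg U (partial j k).
      exact/SmoothBase/smooth_on_partial.
    have -> : pk = fun v => ((partial 1 b v * (delta_mx 0 i : V) 0 0 +
         -1 * (partial 1 a v * (delta_mx 0 i : V) 0 1)) * (jac a b v)^-1) * partial 0 k v +
       ((partial 0 a v * (delta_mx 0 i : V) 0 1 +
         -1 * (partial 0 b v * (delta_mx 0 i : V) 0 0)) * (jac a b v)^-1) * partial 1 k v.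
      by apply/funext => v; rewrite /pk /cramer vec2_0 vec2_1 !mulN1r.
    by do ?[apply: SmoothAdd|apply: SmoothMul|apply: SmoothCst|exact: HJ|exact: Hk|exact: H].
  move=> v /set_mem bv; have [dv dE] := dpsi _ bv.
  rewrite partial_comp //; last exact: smooth_on_diff sk (Upsi _ bv).
  by rewrite partial_diff // dE.
- by exists h.
Unshelve. all: by end_near. Qed.
End inverse_function.

(** * The differential equation of the graph *)

Section pde.
Context {R : realType}.
Notation V := 'rV[R]_2.

(** Bundling the value with differentiability lets the derivative of a compound expression be
    assembled as one term, free of differentiability side conditions. *)
Definition has_partial (i : 'I_2) (f : V -> R) (u : V) (d : R) : Prop :=
  differentiable f u /\ partial i f u = d.

Section rules.
Variables (i : 'I_2) (u : V).
Implicit Types f g : V -> R.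

Lemma has_partialP f : differentiable f u -> has_partial i f u (partial i f u).
Proof. by []. Qed.

Lemma has_partial_eq f d d' : has_partial i f u d -> d = d' -> has_partial i f u d'.
Proof. by move=> h <-. Qed.

Lemma has_partial_cst c : has_partial i (fun=> c) u 0.
Proof. by split; [exact: differentiable_cst|exact: partial_cst]. Qed.

Lemma has_partial_coord j : has_partial i (fun v => v 0 j) u (i == j)%:R.
Proof. by split; [exact: differentiable_coord|exact: partial_coord_id]. Qed.

Lemma has_partialD f g d e : has_partial i f u d -> has_partial i g u e ->
  has_partial i (fun v => f v + g v) u (d + e).
Proof. by move=> [df <-] [dg <-]; split; [exact: differentiableD|exact: partialD]. Qed.

Lemma has_partialM f g d e : has_partial i f u d -> has_partial i g u e ->
  has_partial i (fun v => f v * g v) u (d * g u + f u * e).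
Proof. by move=> [df <-] [dg <-]; split; [exact: differentiableM|exact: partialM]. Qed.

Lemma has_partialN f d : has_partial i f u d -> has_partial i (fun v => - f v) u (- d).
Proof.
move=> [df <-]; split; first exact: differentiableN.
rewrite /partial [LHS](@deriveN _ _ _ f) //; exact: diff_derivable.
Qed.

Lemma has_partialV f d : has_partial i f u d -> f u != 0 ->
  has_partial i (fun v => (f v)^-1) u (- ((f u)^-1 * (f u)^-1 * d)).
Proof. by move=> [df <-] f0; split; [exact: differentiableV|exact: partialV]. Qed.

Lemma has_partial_comp1 (phi : R -> R) (dphi : R) f d :
  is_derive (f u) 1 phi dphi -> has_partial i f u d ->
  has_partial i (fun v => phi (f v)) u (dphi * d).
Proof.
move=> [dp <-] [df <-].
have dp' : differentiable phi (f u) by apply/derivable1_diffP.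
split; first exact: (differentiable_comp df dp').
rewrite partial_diff; last exact: (differentiable_comp df dp').
rewrite (diff_comp df dp') /= [RHS]mulrC -partial_diff //.
rewrite -[X in 'd phi _ X]mulr1 -[_ * 1]/(_ *: (1 : R)) linearZ /=.
by rewrite -deriveE.
Qed.

End rules.

(** Differentiates an identity valid on an open set; the derivatives of both sides come as terms
    built from the rules above. *)
Lemma has_partial_on (D : set V) (f g : V -> R) i u d e : open D -> D u ->
  {in D, f =1 g} -> has_partial i f u d -> has_partial i g u e -> d = e.
Proof.
move=> oD Du fg [_ <-] [_ <-]; apply: (eq_partial i oD fg); exact/mem_set.
Qed.

(** * The gradient (X, Y) and the Hessian entries a, b, c of f: their ratio is constant *)

Section ratio.
Variables (u : V) (r : R) (X Y a b c : V -> R).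
Let B : set V := ball u r.
Hypothesis r0 : 0 < r.
Hypotheses (sX : smooth_on B X) (sY : smooth_on B Y).
Hypotheses (sa : smooth_on B a) (sb : smooth_on B b) (sc : smooth_on B c).
Hypotheses (X0 : {in B, partial 0 X =1 a}) (X1 : {in B, partial 1 X =1 b}).
Hypotheses (Y0 : {in B, partial 0 Y =1 b}) (Y1 : {in B, partial 1 Y =1 c}).
Hypothesis XY : {in B, forall v, X v * b v + Y v * c v = 0}.
Hypothesis H1 : {in B, forall v, partial 1 (fun w => a w * c w - b w * b w) v = 0}.
Hypothesis H0 : {in B, forall v, a v * c v - b v * b v != 0}.

Let oB : open B. Proof. exact: ball_open. Qed.
Let hp f i v : smooth_on B f -> v \in B -> has_partial i f v (partial i f v).
Proof. by move=> sf /set_mem Bv; apply: has_partialP; exact: smooth_on_diff sf Bv. Qed.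
Let pX0 v : v \in B -> has_partial 0 X v (a v). Proof. by move=> Bv; rewrite -X0 //; exact: hp. Qed.
Let pX1 v : v \in B -> has_partial 1 X v (b v). Proof. by move=> Bv; rewrite -X1 //; exact: hp. Qed.
Let pY0 v : v \in B -> has_partial 0 Y v (b v). Proof. by move=> Bv; rewrite -Y0 //; exact: hp. Qed.
Let pY1 v : v \in B -> has_partial 1 Y v (c v). Proof. by move=> Bv; rewrite -Y1 //; exact: hp. Qed.

(** [gam] is half of the x-derivative of X^2 + Y^2, and [XY] says that the y-derivative of X^2 + Y^2
    is zero; hence [gam1] by symmetry of mixed derivatives. *)
Let gam v := X v * a v + Y v * b v.
Let hes v := a v * c v - b v * b v.

Let swapX v : v \in B -> partial 1 a v = partial 0 b v.
Proof.
move=> Bv; rewrite -(eq_partial 1 oB X0 Bv) -(eq_partial 0 oB X1 Bv).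
exact: (partial_partialC _ _ oB sX (set_mem Bv)).
Qed.

Let swapY v : v \in B -> partial 1 b v = partial 0 c v.
Proof.
move=> Bv; rewrite -(eq_partial 1 oB Y0 Bv) -(eq_partial 0 oB Y1 Bv).
exact: (partial_partialC _ _ oB sY (set_mem Bv)).
Qed.

(** Cramer's rule for the system a X + b Y = gam, b X + c Y = 0 in the unknowns X and Y; [hesY] is
    the other component. *)
Let hesX v : v \in B -> hes v * X v = c v * gam v.
Proof.
move=> Bv; have := XY Bv => /eqP; rewrite addrC addr_eq0 => /eqP E.
rewrite /hes /gam mulrDr [c v * (Y v * _)]mulrCA [c v * b v]mulrC [Y v * _]mulrCA E.
by ring.
Qed.

Let hesY v : v \in B -> hes v * Y v = - (b v * gam v).
Proof.
move=> Bv; have := XY Bv => /eqP; rewrite addrC addr_eq0 => /eqP E.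
rewrite /hes mulrBl -[a v * c v * _]mulrA [c v * _]mulrC E /gam.
by ring.
Qed.

(** If gam vanishes at a point, so do X and Y by Cramer's rule. The y-derivative of X b + Y c = 0
    then reduces to b^2 + c^2 = 0 there, against the nonzero Hessian determinant. *)
Let gam0 v : v \in B -> gam v != 0.
Proof.
move=> Bv; apply/negP => /eqP g0; have h0 := H0 Bv.
have x0 : X v = 0 by apply: (mulfI h0); rewrite mulr0 [LHS]hesX // g0 mulr0.
have y0 : Y v = 0 by apply: (mulfI h0); rewrite mulr0 [LHS]hesY // g0 mulr0 oppr0.
have := has_partial_on oB (set_mem Bv) XY
  (has_partialD (has_partialM (pX1 Bv) (hp 1 sb Bv)) (has_partialM (pY1 Bv) (hp 1 sc Bv)))
  (has_partial_cst 1 v 0).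
rewrite x0 y0 !mul0r !addr0 => /eqP.
rewrite paddr_eq0 ?sqr_ge0 -?expr2 ?sqr_ge0 // !sqrf_eq0 => /andP[/eqP b0 /eqP c0].
by move: h0; rewrite b0 c0 mulr0 mul0r subr0 eqxx.
Qed.

Let XYn0 v : v \in B -> X v ^+ 2 + Y v ^+ 2 != 0.
Proof.
move=> Bv; apply: contra (gam0 Bv); rewrite paddr_eq0 ?sqr_ge0 // !sqrf_eq0.
by move=> /andP[/eqP x0 /eqP y0]; rewrite /gam x0 y0 !mul0r addr0.
Qed.

Let gam1 v : v \in B -> has_partial 1 gam v 0.
Proof.
move=> Bv; apply: has_partial_eq
  (has_partialD (has_partialM (pX1 Bv) (hp 1 sa Bv)) (has_partialM (pY1 Bv) (hp 1 sb Bv))) _.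
have := has_partial_on oB (set_mem Bv) XY
  (has_partialD (has_partialM (pX0 Bv) (hp 0 sb Bv)) (has_partialM (pY0 Bv) (hp 0 sc Bv)))
  (has_partial_cst 0 v 0).
rewrite swapX // swapY // => <-.
by move: (partial 0 b v) (partial 0 c v) => *; ring.
Qed.

Let sgam : smooth_on B gam.
Proof.
apply: smooth_algP => //.
by do ?[apply: SmoothAdd|apply: SmoothMul|apply: SmoothBase].
Qed.

Let shes : smooth_on B hes.
Proof.
apply: smooth_algP => //.
have -> : hes = fun v => a v * c v + -1 * (b v * b v).
  by apply/funext => v; rewrite mulN1r.
by do ?[apply: SmoothAdd|apply: SmoothMul|apply: SmoothCst|apply: SmoothBase].
Qed.

Let m v := hes v * (gam v)^-1.

Let sm : smooth_on B m.
Proof.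
apply: smooth_algP => //; apply: SmoothMul; first exact: (SmoothBase shes).
by apply: SmoothInv => [|v /mem_set]; [exact: (SmoothBase sgam)|exact: gam0].
Qed.

Let m_neq0 v : v \in B -> m v != 0.
Proof. by move=> Bv; rewrite mulf_neq0 ?invr_eq0 ?gam0 //; exact: H0. Qed.

Let m1 v : v \in B -> has_partial 1 m v 0.
Proof.
move=> Bv; have ph := hp 1 shes Bv; rewrite {2}/hes H1 // in ph.
apply: has_partial_eq (has_partialM ph (has_partialV (gam1 Bv) (gam0 Bv))) _.
by rewrite mulr0 oppr0 mulr0 mul0r addr0.
Qed.

Let cE : {in B, forall v, c v = m v * X v}.
Proof.
by move=> v Bv; rewrite /m mulrAC hesX // mulfK // gam0.
Qed.

Let bE : {in B, forall v, b v = - (m v * Y v)}.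
Proof.
by move=> v Bv; rewrite /m mulrAC hesY // mulNr mulfK ?opprK // gam0.
Qed.

Let m0 v := partial 0 m v.

Let sm0 : smooth_on B m0. Proof. exact: smooth_on_partial. Qed.

Let m01 v : v \in B -> has_partial 1 m0 v 0.
Proof.
move=> Bv; apply: has_partial_eq (hp 1 sm0 Bv) _.
rewrite /m0 (partial_partialC 1 0 oB sm (set_mem Bv)).
have E : {in B, partial 1 m =1 fun=> 0} by move=> w Bw; case: (m1 Bw).
by rewrite (eq_partial 0 oB E Bv) partial_cst.
Qed.

(** The symmetry c_x = b_y of the third derivatives, written with c = m X, b = - m Y and m_y = 0. *)
Let m0X : {in B, forall v, m0 v * X v + m v * a v = - (m v * (m v * X v))}.
Proof.
move=> v Bv.
have c0 := has_partial_on oB (set_mem Bv) cE (hp 0 sc Bv) (has_partialM (hp 0 sm Bv) (pX0 Bv)).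
have b1 := has_partial_on oB (set_mem Bv) bE (hp 1 sb Bv)
  (has_partialN (has_partialM (m1 Bv) (pY1 Bv))).
by rewrite -[LHS]c0 -swapY // b1 mul0r add0r cE.
Qed.

(** [m0X] times X, with X a replaced by gam - Y b = gam + m Y^2. Apart from the first X^2, it is an
    expression in quantities independent of y: m0, m, gam and X^2 + Y^2. *)
Let m0w : {in B, forall v,
  m0 v * (X v * X v) + (m v * gam v + m v * m v * (X v * X v + Y v * Y v)) = 0}.
Proof.
move=> v Bv; have := m0X Bv; rewrite /gam bE // => /eqP; rewrite -subr_eq0 opprK => /eqP E.
by rewrite -[RHS](mul0r (X v)) -[X in _ = X * _]E; ring.
Qed.

(** The y-derivative of [m0w] leaves only m0 (X^2)_y, and X_y = b = - m Y. *)
Let m0XY : {in B, forall v, m0 v * (X v * Y v) = 0}.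
Proof.
move=> v Bv.
have := has_partial_on oB (set_mem Bv) m0w
  (has_partialD (has_partialM (m01 Bv) (has_partialM (pX1 Bv) (pX1 Bv)))
    (has_partialD (has_partialM (m1 Bv) (gam1 Bv))
       (has_partialM (has_partialM (m1 Bv) (m1 Bv))
         (has_partialD (has_partialM (pX1 Bv) (pX1 Bv)) (has_partialM (pY1 Bv) (pY1 Bv))))))
  (has_partial_cst 1 v 0).
rewrite bE // cE // => E.
have /mulfI : 2 * m v != 0 by rewrite mulf_neq0 ?m_neq0 // pnatr_eq0.
by apply; rewrite mulr0 -[RHS]oppr0 -E; ring.
Qed.

(** The y-derivative of [m0XY] gives m0 (X^2 - Y^2) = 0. Where m0 is nonzero, this and X Y = 0 force
    X = Y = 0, which [XYn0] excludes. *)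
Let m0_eq0 : {in B, forall v, m0 v = 0}.
Proof.
move=> v Bv.
have := has_partial_on oB (set_mem Bv) m0XY
  (has_partialM (m01 Bv) (has_partialM (pX1 Bv) (pY1 Bv))) (has_partial_cst 1 v 0).
rewrite bE // cE // => E.
have E2 : m0 v * (X v * X v - Y v * Y v) = 0.
  by apply: (mulfI (m_neq0 Bv)); rewrite mulr0 -E; ring.
apply/eqP; apply: contraTT (XYn0 Bv) => m00; apply/negPn.
have /eqP : X v * Y v = 0 by apply: (mulfI m00); rewrite mulr0 m0XY.
have /eqP : X v * X v - Y v * Y v = 0 by apply: (mulfI m00); rewrite mulr0.
rewrite mulf_eq0 subr_eq0 => /eqP E3 /orP[/eqP x0|/eqP y0].
  by rewrite expr2 E3 -expr2 -mulr2n mulrn_eq0 /= sqrf_eq0 -[Y v == 0]sqrf_eq0 expr2 -E3 x0 mul0r.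
by rewrite [Y v ^+ 2]expr2 -E3 -expr2 -mulr2n mulrn_eq0 /= sqrf_eq0 -[X v == 0]sqrf_eq0 expr2 E3 y0 mul0r.
Qed.

Lemma ratio_constant : exists2 k : R, k != 0 & {in B, forall v,
  [/\ a v = k * X v, b v = k * Y v, c v = - (k * X v) & X v ^+ 2 + Y v ^+ 2 != 0]}.
Proof.
have Bu : B u by exact: ballxx.
exists (- m u); first by rewrite oppr_eq0 m_neq0 //; exact: mem_set.
have mE v : v \in B -> m u = m v.
  move=> /set_mem Bv; apply: (@constant_on_ball _ m u r) => //.
    by move=> w; apply: smooth_on_diff.
  move=> w i /mem_set Bw; elim/ord2_ind: i; first exact: m0_eq0.
  by case: (m1 Bw).
move=> v Bv; rewrite (mE v Bv) mulNr opprK; split => //.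
- have E : m v * a v = m v * (- (m v * X v)).
    by rewrite mulrN -(m0X Bv) m0_eq0 // mul0r add0r.
  exact: (mulfI (m_neq0 Bv) E).
- by rewrite bE // mulNr.
- by rewrite cE.
- exact: XYn0.
Qed.
End ratio.

Lemma polar_coordinates (E F : R) : E ^+ 2 + F ^+ 2 != 0 ->
  exists2 A : R, 0 < A & exists t : R, E = A * cos t /\ F = A * sin t.
Proof.
move=> EF0; have EFp : 0 < E ^+ 2 + F ^+ 2 by rewrite lt_def EF0 addr_ge0 ?sqr_ge0.
pose A := Num.sqrt (E ^+ 2 + F ^+ 2).
have A0 : 0 < A by rewrite sqrtr_gt0.
have A2 : A ^+ 2 = E ^+ 2 + F ^+ 2 by rewrite sqr_sqrtr // ltW.
exists A => //.
have F2 : 1 - (E / A) ^+ 2 = (F / A) ^+ 2.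
  rewrite !exprMn !exprVn A2; move: EF0; rewrite !expr2 => EF0; by field.
have EA : -1 <= E / A <= 1.
  have : (E / A) ^+ 2 <= 1 by rewrite -subr_ge0 F2 sqr_ge0.
  by move: (E / A) => z z1; apply/andP; split; nra.
have cE : cos (acos (E / A)) = E / A by rewrite acosK // in_itv.
have sE : sin (acos (E / A)) = `|F / A|.
  by rewrite sin_acos // F2 sqrtr_sqr.
(* [acos] gives the angle with nonnegative sine; for F < 0 the opposite angle is taken. *)
have [F0|F0] := leP 0 F.
  exists (acos (E / A)); rewrite cE sE ger0_norm ?divr_ge0 ?(ltW A0) //.
  by split; rewrite mulrC divfK // gt_eqF.
exists (- acos (E / A)); rewrite cosN sinN cE sE ltr0_norm; last first.
  by rewrite pmulr_llt0 // invr_gt0.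
by rewrite opprK; split; rewrite mulrC divfK // gt_eqF.
Qed.

Definition grad_sq (f : V -> R) (v : V) : R := partial 0 f v ^+ 2 + partial 1 f v ^+ 2.

Definition hess_det (f : V -> R) (v : V) : R :=
  partial 0 (partial 0 f) v * partial 1 (partial 1 f) v
  - partial 0 (partial 1 f) v * partial 1 (partial 0 f) v.

Section solution.
Variables (u : V) (r k : R) (X Y : V -> R).
Let B : set V := ball u r.
Hypothesis r0 : 0 < r.
Hypotheses (dX : forall v, B v -> differentiable X v) (dY : forall v, B v -> differentiable Y v).
Hypotheses (X0 : forall v, B v -> partial 0 X v = k * X v)
  (X1 : forall v, B v -> partial 1 X v = k * Y v)
  (Y0 : forall v, B v -> partial 0 Y v = k * Y v)
  (Y1 : forall v, B v -> partial 1 Y v = - (k * X v)).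

(* [X + i Y] turns into a constant once multiplied by [exp (- k (x - i y))]. *)
Lemma rotation_solution : exists E F : R, forall v, B v ->
  X v = expR (k * v 0 0) * (E * cos (k * v 0 1) + F * sin (k * v 0 1)) /\
  Y v = expR (k * v 0 0) * (F * cos (k * v 0 1) - E * sin (k * v 0 1)).
Proof.
pose e (v : V) : R := expR (- k * v 0 0).
pose co (v : V) : R := cos (k * v 0 1).
pose si (v : V) : R := sin (k * v 0 1).
have pe i v : has_partial i e v (e v * (- k * (i == 0)%:R)).
  apply: has_partial_comp1; apply: has_partial_eq (has_partialM (has_partial_cst _ _ _) (has_partial_coord _ _ _)) _.
  by rewrite mul0r add0r.
have pc i v : has_partial i co v (- si v * (k * (i == 1)%:R)).
  apply: has_partial_comp1; apply: has_partial_eq (has_partialM (has_partial_cst _ _ _) (has_partial_coord _ _ _)) _.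
  by rewrite mul0r add0r.
have ps i v : has_partial i si v (co v * (k * (i == 1)%:R)).
  apply: has_partial_comp1; apply: has_partial_eq (has_partialM (has_partial_cst _ _ _) (has_partial_coord _ _ _)) _.
  by rewrite mul0r add0r.
have pX i v : B v -> has_partial i X v (k * (if i == 0 then X v else Y v)).
  by move=> Bv; split; [exact: dX|elim/ord2_ind: i; [exact: X0|exact: X1]].
have pY i v : B v -> has_partial i Y v (k * (if i == 0 then Y v else - X v)).
  move=> Bv; split; first exact: dY.
  by elim/ord2_ind: i; [exact: Y0|rewrite mulrN; exact: Y1].
pose E v := e v * (X v * co v + - (Y v * si v)).
pose F v := e v * (X v * si v + Y v * co v).
have pE i v : B v -> has_partial i E v 0.
  move=> Bv; apply: has_partial_eq (has_partialM (pe i v) (has_partialD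
    (has_partialM (pX i v Bv) (pc i v)) (has_partialN (has_partialM (pY i v Bv) (ps i v))))) _.
  elim/ord2_ind: i => /=; ring.
have pF i v : B v -> has_partial i F v 0.
  move=> Bv; apply: has_partial_eq (has_partialM (pe i v) (has_partialD
    (has_partialM (pX i v Bv) (ps i v)) (has_partialM (pY i v Bv) (pc i v)))) _.
  elim/ord2_ind: i => /=; ring.
exists (E u), (F u) => v Bv.
have Bu : B u by exact: ballxx.
have -> : E u = E v.
  by apply: (@constant_on_ball _ E u r) => // [w Bw|w i Bw]; [case: (pE 0 w Bw)|case: (pE i w Bw)].
have -> : F u = F v.
  by apply: (@constant_on_ball _ F u r) => // [w Bw|w i Bw]; [case: (pF 0 w Bw)|case: (pF i w Bw)].
have ee : expR (k * v 0 0) * e v = 1 by rewrite /e -expRD mulNr subrr expR0.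
have cs : co v ^+ 2 + si v ^+ 2 = 1 by rewrite cos2Dsin2.
rewrite /E /F -/(co v) -/(si v); split.
  rewrite -[LHS]mul1r -ee -[LHS]mulr1 -cs; ring.
rewrite -[LHS]mul1r -ee -[LHS]mulr1 -cs; ring.
Qed.
End solution.

Theorem graph_pde_solution (f : V -> R) (u : V) (r : R) : 0 < r ->
  smooth_on (ball u r) f ->
  (forall v, ball u r v -> partial 1 (grad_sq f) v = 0) ->
  (forall v, ball u r v -> partial 1 (hess_det f) v = 0) ->
  (forall v, ball u r v -> hess_det f v != 0) ->
  exists k A s d : R, [/\ k != 0, 0 < A & forall v, ball u r v ->
    [/\ f v = A / k * expR (k * v 0 0) * cos (k * (v 0 1 - s)) + d,
        grad_sq f v = (A * expR (k * v 0 0)) ^+ 2 &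
        hess_det f v = - (k ^+ 2 * grad_sq f v)]].
Proof.
move=> r0 sf G1 H1 H0.
pose B : set V := ball u r.
have oB : open B by exact: ball_open.
have sX := smooth_on_partial 0 sf; have sY := smooth_on_partial 1 sf.
have YX : {in B, partial 0 (partial 1 f) =1 partial 1 (partial 0 f)}.
  by move=> v /set_mem Bv; exact: (partial_partialC 0 1 oB sf Bv).
have hp (g : V -> R) i v : smooth_on (ball u r) g -> ball u r v ->
    has_partial i g v (partial i g v).
  by move=> sg Bv; apply: has_partialP; exact: smooth_on_diff sg Bv.
have XYe : {in B, forall v, partial 0 f v * partial 1 (partial 0 f) v +
    partial 1 f v * partial 1 (partial 1 f) v = 0}.
  move=> v /set_mem Bv; have := G1 v Bv.
  have -> : grad_sq f = fun w => partial 0 f w * partial 0 f w + partial 1 f w * partial 1 f w.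
    by apply/funext => w; rewrite /grad_sq !expr2.
  rewrite (has_partialD (has_partialM (hp _ 1 v sX Bv) (hp _ 1 v sX Bv))
    (has_partialM (hp _ 1 v sY Bv) (hp _ 1 v sY Bv))).2.
  move: (partial 0 f v) (partial 1 f v) (partial 1 (partial 0 f) v)
    (partial 1 (partial 1 f) v) => p q p1 q1; lra.
have hE : {in B, hess_det f =1 fun v => partial 0 (partial 0 f) v * partial 1 (partial 1 f) v -
    partial 1 (partial 0 f) v * partial 1 (partial 0 f) v}.
  by move=> w Bw; rewrite /hess_det YX.
have H1e := fun v (Bv : v \in B) =>
  etrans (esym (eq_partial 1 oB hE Bv)) (H1 v (set_mem Bv)).
have H0e : {in B, forall v, partial 0 (partial 0 f) v * partial 1 (partial 1 f) v -
    partial 1 (partial 0 f) v * partial 1 (partial 0 f) v != 0}.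
  by move=> v Bv; rewrite -[X in X != 0](hE v Bv); exact: H0 (set_mem Bv).
have [k k0 kP] := ratio_constant r0 sX sY (smooth_on_partial 0 sX) (smooth_on_partial 1 sX)
  (smooth_on_partial 1 sY) (fun v _ => erefl) (fun v _ => erefl) YX (fun v _ => erefl)
  XYe H1e H0e.
have kB v (Bv : ball u r v) := kP v (mem_set Bv).
have [E [F EF]] : exists E F : R, forall v, ball u r v ->
    partial 0 f v = expR (k * v 0 0) * (E * cos (k * v 0 1) + F * sin (k * v 0 1)) /\
    partial 1 f v = expR (k * v 0 0) * (F * cos (k * v 0 1) - E * sin (k * v 0 1)).
  apply: (@rotation_solution u r k) => // v Bv.
  - exact: smooth_on_diff sX Bv.
  - exact: smooth_on_diff sY Bv.
  - by have [] := kB v Bv.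
  - by have [] := kB v Bv.
  - by rewrite YX; [have [] := kB v Bv|exact: mem_set].
  - by have [] := kB v Bv.
have gE v : ball u r v -> grad_sq f v = (E ^+ 2 + F ^+ 2) * expR (k * v 0 0) ^+ 2.
  move=> Bv; rewrite /grad_sq; have [-> ->] := EF v Bv.
  have := cos2Dsin2 (k * v 0 1); move: (cos _) (sin _) (expR _) => C S e cs.
  by rewrite -[RHS]mulr1 -cs; ring.
have EF0 : E ^+ 2 + F ^+ 2 != 0.
  have Bu : ball u r u by exact: ballxx.
  have [_ _ _] := kB u Bu; rewrite -[X in X != 0]/(grad_sq f u) gE //.
  by rewrite mulf_eq0 negb_or => /andP[].
have [A A0 [t [EA FA]]] := polar_coordinates EF0.
have A2 : E ^+ 2 + F ^+ 2 = A ^+ 2.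
  by rewrite EA FA -[RHS]mulr1 -(cos2Dsin2 t); ring.
(* f - f_x / k has zero gradient, as f_xx = k f_x and f_xy = k f_y; its constant value is the height
   [d]. *)
pose g v : R := f v + - (k^-1 * partial 0 f v).
have pg i v : ball u r v -> has_partial i g v 0.
  move=> Bv; apply: has_partial_eq (has_partialD (hp _ i v sf Bv)
    (has_partialN (has_partialM (has_partial_cst _ _ _) (hp _ i v sX Bv)))) _.
  have [e0 e1 _ _] := kB v Bv.
  elim/ord2_ind: i; rewrite ?e0 ?e1 mul0r add0r mulrA mulVf // mul1r subrr //.
have Bu : ball u r u by exact: ballxx.
(* With E = A cos t and F = A sin t, the sum E cos (k y) + F sin (k y) is A cos (k y - t); hence s =
   t / k. *)
exists k, A, (t / k), (g u); split => // v Bv; split.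
- have -> : g u = g v.
    by apply: (@constant_on_ball _ g u r) => // [w Bw|w i Bw]; [case: (pg 0 w Bw)|case: (pg i w Bw)].
  rewrite /g; have [-> _] := EF v Bv; rewrite mulrBr [k * (t / k)]mulrC divfK // cosB EA FA.
  by move: (f v) (cos _) (sin _) (cos _) (sin _) (expR _) => *; field.
- by rewrite gE // A2 exprMn.
- have [e0 e1 e2 _] := kB v Bv; rewrite /hess_det /grad_sq YX ?mem_set // e0 e1 e2.
  by move: (partial 0 f v) (partial 1 f v) => *; ring.
Qed.
End pde.

(** * Smooth maps composed with linear maps *)

Section linear_images.
Context {R : realType}.
Notation V := 'rV[R]_2.

Lemma partial_linear (W W' : normedModType R) (L : {linear W -> W'}) (F : V -> W) i u :
  continuous L -> differentiable F u ->
  differentiable (L \o F) u /\ partial i (L \o F) u = L (partial i F u).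
Proof.
move=> cL dF; have dL : differentiable L (F u) by exact: linear_differentiable.
have dLF := differentiable_comp dF dL; split=> //.
by rewrite !partial_diff // diff_comp //= diff_lin.
Qed.

Lemma smooth_on_linear (W W' : normedModType R) (L : {linear W -> W'}) (D : set V)
    (F : V -> W) : open D -> continuous L -> smooth_on D F -> smooth_on D (L \o F).
Proof.
move=> oD cL sF.
apply: (@smooth_on_coind _ _ _ (fun f => exists2 G, smooth_on D G & f = L \o G)) => //; last by exists F.
move=> _ [G sG ->]; split.
  by move=> u Du; apply: (partial_linear 0 cL (smooth_on_diff sG Du)).1.
move=> i; exists (L \o partial i G).
  by exists (partial i G) => //; exact: smooth_on_partial.
by move=> u /set_mem Du; rewrite (partial_linear i cL (smooth_on_diff sG Du)).2.
Qed.

Lemma coord_linear (n : nat) (j : 'I_n) : linear (fun v : 'rV[R]_n => v 0 j).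
Proof. by move=> a u v; rewrite !mxE. Qed.

Definition coord_lin (n : nat) (j : 'I_n) : {linear 'rV[R]_n -> R} :=
  HB.pack (fun v : 'rV[R]_n => v 0 j)
    (GRing.isLinear.Build R 'rV[R]_n R _ (fun v : 'rV[R]_n => v 0 j) (coord_linear j)).

Lemma smooth_on_coord (n : nat) (D : set V) (F : V -> 'rV[R]_n) j :
  open D -> smooth_on D F -> smooth_on D (fun v => F v 0 j : R).
Proof.
move=> oD; apply: (@smooth_on_linear _ _ (coord_lin j)) => //.
exact: coord_continuous.
Qed.

Lemma smooth_on_vec2 (D : set V) (a b : V -> R) : open D ->
  smooth_on D a -> smooth_on D b -> smooth_on D (fun v => vec2 (a v) (b v)).
Proof.
move=> oD sa sb.
apply: (@smooth_on_coind _ _ _ (fun f => exists a' b', [/\ smooth_on D a', smooth_on D b' &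
  f = fun v => vec2 (a' v) (b' v)])) => //; last by exists a, b.
move=> _ [a' [b' [sa' sb' ->]]]; split.
  by move=> u Du; apply: differentiable_vec2; [exact: smooth_on_diff sa' Du|exact: smooth_on_diff sb' Du].
move=> i; exists (fun v => vec2 (partial i a' v) (partial i b' v)).
  by exists (partial i a'), (partial i b'); split=> //; exact: smooth_on_partial.
by move=> u /set_mem Du; rewrite partial_vec2 //; [exact: smooth_on_diff sa' Du|exact: smooth_on_diff sb' Du].
Qed.

Lemma dot_linear (n : nat) (e : 'rV[R]_n) : linear (fun v => dot v e : R).
Proof.
move=> k v w; transitivity (k * dot v e + dot w e) => //.
rewrite /dot big_distrr -big_split /=.
by apply: eq_bigr => i _; rewrite !mxE mulrDl mulrA.
Qed.

Definition dot_lin (n : nat) (e : 'rV[R]_n) : {linear 'rV[R]_n -> R} :=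
  HB.pack (fun v : 'rV[R]_n => dot v e : R)
    (GRing.isLinear.Build R 'rV[R]_n R _ (fun v : 'rV[R]_n => dot v e : R) (dot_linear e)).

Lemma dot_lin_continuous (n : nat) (e : 'rV[R]_n) : continuous (dot_lin e).
Proof.
move=> v; apply: differentiable_continuous.
have -> : (dot_lin e : 'rV[R]_n -> R) = \sum_(i < n) (fun w : 'rV[R]_n => w 0 i * e 0 i).
  by apply/funext => w; rewrite /= /dot fct_sumE.
apply: differentiable_sum => i; apply: differentiableM => //.
exact: differentiable_coord.
Qed.
End linear_images.

(** * Orthonormal frames and vector identities in three dimensions *)

Section frame.
Context {R : realType}.
Implicit Types v w : 'rV[R]_3.

Let crd v k := v 0 (inord k).

Lemma dot3E v w : dot v w = crd v 0 * crd w 0 + crd v 1 * crd w 1 + crd v 2 * crd w 2.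
Proof.
rewrite /dot !big_ord_recl big_ord0 addr0 addrA /crd.
congr (_ + _ + _); congr (v _ _ * w _ _); apply/val_inj; rewrite /= inordK //.
Qed.

Lemma row3E (a b c : R) :
  [/\ crd (row3 a b c) 0 = a, crd (row3 a b c) 1 = b & crd (row3 a b c) 2 = c].
Proof. by rewrite /crd /row3 !mxE !inordK. Qed.

Lemma row3_inj v w : crd v 0 = crd w 0 -> crd v 1 = crd w 1 -> crd v 2 = crd w 2 -> v = w.
Proof.
move=> v0 v1 v2; apply/rowP => i.
have [->|[->|->]] : i = inord 0 \/ i = inord 1 \/ i = inord 2.
  by case: i => -[|[|[|//]]] i3; [left|right; left|right; right]; apply/val_inj; rewrite /= inordK.
- exact: v0.
- exact: v1.
- exact: v2.
Qed.

Lemma cross3E v w :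
  [/\ crd (cross v w) 0 = crd v 1 * crd w 2 - crd v 2 * crd w 1,
      crd (cross v w) 1 = crd v 2 * crd w 0 - crd v 0 * crd w 2 &
      crd (cross v w) 2 = crd v 0 * crd w 1 - crd v 1 * crd w 0].
Proof. by have [] := row3E (crd v 1 * crd w 2 - crd v 2 * crd w 1)
  (crd v 2 * crd w 0 - crd v 0 * crd w 2) (crd v 0 * crd w 1 - crd v 1 * crd w 0). Qed.

Lemma lagrange_identity v w :
  dot (cross v w) (cross v w) = dot v v * dot w w - dot v w ^+ 2.
Proof.
rewrite !dot3E; have [-> -> ->] := cross3E v w.
move: (crd v 0) (crd v 1) (crd v 2) (crd w 0) (crd w 1) (crd w 2) => *; ring.
Qed.

Lemma dotC v w : dot v w = dot w v.
Proof. by rewrite /dot; apply: eq_bigr => i _; rewrite mulrC. Qed.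

Lemma dot_cross_l v w : dot v (cross v w) = 0.
Proof.
rewrite !dot3E; have [-> -> ->] := cross3E v w.
move: (crd v 0) (crd v 1) (crd v 2) (crd w 0) (crd w 1) (crd w 2) => *; ring.
Qed.

Lemma dot_cross_r v w : dot w (cross v w) = 0.
Proof.
rewrite !dot3E; have [-> -> ->] := cross3E v w.
move: (crd v 0) (crd v 1) (crd v 2) (crd w 0) (crd w 1) (crd w 2) => *; ring.
Qed.

(* The right-hand side is the determinant of the matrix of inner products. *)
Lemma triple_product_mul v w z a b c :
  dot v (cross w z) * dot a (cross b c) =
  dot v a * (dot w b * dot z c - dot w c * dot z b) +
  dot v b * (dot w c * dot z a - dot w a * dot z c) +
  dot v c * (dot w a * dot z b - dot w b * dot z a).
Proof.
rewrite !dot3E; have [-> -> ->] := cross3E w z; have [-> -> ->] := cross3E b c.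
move: (crd v 0) (crd v 1) (crd v 2) (crd w 0) (crd w 1) (crd w 2) (crd z 0) (crd z 1) (crd z 2).
move: (crd a 0) (crd a 1) (crd a 2) (crd b 0) (crd b 1) (crd b 2) (crd c 0) (crd c 1) (crd c 2).
move=> *; ring.
Qed.

Variables e1 e2 : 'rV[R]_3.
Hypothesis fr : cartesian_frame e1 e2.
Let e3 := cross e1 e2.

Let e33 : dot e3 e3 = 1.
Proof. by case: fr => e11 e22 e12; rewrite lagrange_identity e11 e22 e12 expr0n subr0 mulr1. Qed.

(** The vectors are the columns, since points are rows and the rigid motion acts from the right. *)
Definition frame_mx (a b c : 'rV[R]_3) : 'M[R]_3 :=
  \matrix_(i, j) (if j == 0 :> nat then a else if j == 1 :> nat then b else c) 0 i.

Lemma mul_frame_mx v a b c : v *m frame_mx a b c = row3 (dot v a) (dot v b) (dot v c).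
Proof.
have [r0 r1 r2] := row3E (dot v a) (dot v b) (dot v c).
apply: row3_inj; rewrite ?r0 ?r1 ?r2 /crd !mxE /dot; apply: eq_bigr => i _; rewrite mxE inordK //.
Qed.

Lemma frame_mx_orthogonal : frame_mx e1 e2 e3 *m (frame_mx e1 e2 e3)^T = 1%:M.
Proof.
apply: mulmx1C; case: fr => e11 e22 e12.
have e13 : dot e1 e3 = 0 by exact: dot_cross_l.
have e23 : dot e2 e3 = 0 by exact: dot_cross_r.
apply/matrixP => i j; rewrite mxE.
pose e (i : 'I_3) := if i == 0 :> nat then e1 else if i == 1 :> nat then e2 else e3.
transitivity (dot (e i) (e j)).
  by rewrite /dot; apply: eq_bigr => k _; rewrite !mxE.
rewrite mxE -val_eqE /e /=.
by case: i => -[|[|[|//]]] i3; case: j => -[|[|[|//]]] j3 //=; rewrite dotC.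
Qed.

Lemma frame_mx_det (a b c : 'rV[R]_3) : \det (frame_mx a b c) = dot c (cross a b).
Proof.
have E0 : inord 0 = ord0 :> 'I_3 by apply/val_inj; rewrite /= inordK.
have E1 : inord 1 = lift ord0 ord0 :> 'I_3 by apply/val_inj; rewrite /= inordK.
have E2 : inord 2 = lift ord0 (lift ord0 ord0) :> 'I_3 by apply/val_inj; rewrite /= inordK.
rewrite dot3E; have [-> -> ->] := cross3E a b; rewrite /crd E0 E1 E2.
rewrite (expand_det_row _ ord0) !big_ord_recl big_ord0 /cofactor.
rewrite !(expand_det_row _ ord0) !big_ord_recl !big_ord0 /cofactor !det_mx11 !mxE /=.
have -> : (0 : 'I_1) = ord0 by apply/val_inj.
rewrite /bump /= !add0n !addn0 expr0 expr1.
move: (a 0 _) (a 0 _) (a 0 _) (b 0 _) (b 0 _) (b 0 _) (c 0 _) (c 0 _) (c 0 _).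
by move=> *; ring.
Qed.

(** The matrix [frame_mx e1 e2 e3] is orthogonal, so it preserves inner products. *)
Lemma frame_dot v w :
  dot v w = dot v e1 * dot w e1 + dot v e2 * dot w e2 + dot v e3 * dot w e3.
Proof.
have dotE (x y : 'rV[R]_3) : dot x y = (x *m y^T) 0 0.
  by rewrite mxE /dot; apply: eq_bigr => i _; rewrite [y^T _ _]mxE.
rewrite dotE -[v in LHS]mulmx1 -frame_mx_orthogonal mulmxA -(mulmxA _ _ w^T) -trmx_mul -dotE.
rewrite !mul_frame_mx dot3E.
have [-> -> ->] := row3E (dot v e1) (dot v e2) (dot v e3).
by have [-> -> ->] := row3E (dot w e1) (dot w e2) (dot w e3).
Qed.

(** [triple_product_mul] with the frame as second triple, whose own triple product
    [dot e3 (cross e1 e2)] is 1. *)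
Lemma frame_triple v w z : dot v (cross w z) =
  dot v e1 * (dot w e2 * dot z e3 - dot w e3 * dot z e2) +
  dot v e2 * (dot w e3 * dot z e1 - dot w e1 * dot z e3) +
  dot v e3 * (dot w e1 * dot z e2 - dot w e2 * dot z e1).
Proof.
have := triple_product_mul v w z e3 e1 e2; rewrite -/e3 e33 mulr1 => ->.
by ring.
Qed.
End frame.

(** * Fundamental forms in coordinates *)

Section forms.
Context {R : realType}.
Notation V := 'rV[R]_2.

Lemma det_mx22 (M : 'M[R]_2) : \det M = M 0 0 * M 1 1 - M 0 1 * M 1 0.
Proof.
have E1 : lift 0 0 = 1 :> 'I_2 by apply/val_inj.
have E1' : lift ord0 0 = 1 :> 'I_2 by apply/val_inj.
have E1'' : lift ord0 ord0 = 1 :> 'I_2 by apply/val_inj.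
have E0 : lift 1 0 = 0 :> 'I_2 by apply/val_inj.
have E0' : ord0 = 0 :> 'I_2 by apply/val_inj.
rewrite (expand_det_row _ 0) !big_ord_recl big_ord0 /cofactor !det_mx11 !mxE /=.
rewrite !E1 ?E1' ?E1'' !E0 ?E0' /bump /= !addn0 add0n expr0 expr1.
by move: (M 0 0) (M 0 1) (M 1 0) (M 1 1) => *; ring.
Qed.

(** [metric_det] is [EG - F^2] for the surface with coordinates [X], [Y], [Z];
    [curvature_num] is the determinant of its second form taken with the unnormalized
    normal. *)
Definition metric_det (X Y Z : V -> R) (u : V) : R :=
  (partial 0 X u ^+ 2 + partial 0 Y u ^+ 2 + partial 0 Z u ^+ 2) *
  (partial 1 X u ^+ 2 + partial 1 Y u ^+ 2 + partial 1 Z u ^+ 2) -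
  (partial 0 X u * partial 1 X u + partial 0 Y u * partial 1 Y u
   + partial 0 Z u * partial 1 Z u) ^+ 2.

Definition normal_second (X Y Z : V -> R) (i j : 'I_2) (u : V) : R :=
  partial i (partial j X) u *
    (partial 0 Y u * partial 1 Z u - partial 0 Z u * partial 1 Y u) +
  partial i (partial j Y) u *
    (partial 0 Z u * partial 1 X u - partial 0 X u * partial 1 Z u) +
  partial i (partial j Z) u *
    (partial 0 X u * partial 1 Y u - partial 0 Y u * partial 1 X u).

Definition curvature_num (X Y Z : V -> R) (u : V) : R :=
  normal_second X Y Z 0 0 u * normal_second X Y Z 1 1 u -
  normal_second X Y Z 0 1 u * normal_second X Y Z 1 0 u.

Lemma metric_det_eq (X Y Z : V -> R) u (x0 x1 y0 y1 z0 z1 : R) :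
  partial 0 X u = x0 -> partial 1 X u = x1 -> partial 0 Y u = y0 -> partial 1 Y u = y1 ->
  partial 0 Z u = z0 -> partial 1 Z u = z1 ->
  metric_det X Y Z u = (x0 ^+ 2 + y0 ^+ 2 + z0 ^+ 2) * (x1 ^+ 2 + y1 ^+ 2 + z1 ^+ 2) -
    (x0 * x1 + y0 * y1 + z0 * z1) ^+ 2.
Proof. by move=> <- <- <- <- <- <-. Qed.

Lemma normal_second_eq (X Y Z : V -> R) i j u (x y z x0 x1 y0 y1 z0 z1 : R) :
  partial i (partial j X) u = x -> partial i (partial j Y) u = y ->
  partial i (partial j Z) u = z ->
  partial 0 X u = x0 -> partial 1 X u = x1 -> partial 0 Y u = y0 -> partial 1 Y u = y1 ->
  partial 0 Z u = z0 -> partial 1 Z u = z1 ->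
  normal_second X Y Z i j u =
    x * (y0 * z1 - z0 * y1) + y * (z0 * x1 - x0 * z1) + z * (x0 * y1 - y0 * x1).
Proof. by move=> <- <- <- <- <- <- <- <- <-. Qed.

Section coordinates.
Variables (o e1 e2 : 'rV[R]_3) (D : set V) (F : V -> 'rV[R]_3).
Hypotheses (fr : cartesian_frame e1 e2) (oD : open D) (sF : smooth_on D F).
Let e3 := cross e1 e2.

Let crd (e : 'rV[R]_3) (v : V) : R := dot (F v - o) e.

Let crdE e v : crd e v = dot_lin e (F v) + - dot o e.
Proof. exact: (linearB (dot_lin e)). Qed.

Lemma smooth_on_crd e : smooth_on D (crd e).
Proof.
rewrite (_ : crd e = fun v => dot_lin e (F v) + - dot o e); last exact/funext/crdE.
apply: smooth_algP => //; apply: SmoothAdd; last exact: SmoothCst.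
apply: SmoothBase; apply: smooth_on_linear => //; exact: dot_lin_continuous.
Qed.

Lemma partial_crd e i v : D v -> partial i (crd e) v = dot (partial i F v) e.
Proof.
move=> Dv; rewrite (_ : crd e = fun v => dot_lin e (F v) + - dot o e); last exact/funext/crdE.
have [dL pL] := partial_linear i (@dot_lin_continuous R 3 e) (smooth_on_diff sF Dv).
by rewrite partialD ?partial_cst ?addr0 //; exact: differentiable_cst.
Qed.

Lemma partial2_crd e i j v : D v ->
  partial i (partial j (crd e)) v = dot (partial i (partial j F) v) e.
Proof.
move=> Dv.
have E : {in D, partial j (crd e) =1 dot_lin e \o partial j F}.
  by move=> w /set_mem Dw; exact: partial_crd.
rewrite (eq_partial i oD E (mem_set Dv)).
by have [_] := partial_linear i (@dot_lin_continuous R 3 e)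
  (smooth_on_diff (smooth_on_partial j sF) Dv).
Qed.

Lemma first_form_det u : D u ->
  \det (first_form F u) = metric_det (crd e1) (crd e2) (crd e3) u.
Proof.
move=> Du; pose d i e : R := dot (partial i F u) e.
have p i e : partial i (crd e) u = d i e := partial_crd e i Du.
have E i j : first_form F u i j = d i e1 * d j e1 + d i e2 * d j e2 + d i e3 * d j e3.
  by rewrite mxE (frame_dot fr).
clearbody d; rewrite (metric_det_eq (p 0 e1) (p 1 e1) (p 0 e2) (p 1 e2) (p 0 e3) (p 1 e3)).
by rewrite det_mx22 !E; ring.
Qed.

(** Each entry of the second form carries a factor 1 / |w| from the unit normal, and |w|^2 is the
    metric determinant by Lagrange's identity; hence the square of that determinant in the
    denominator. *)
Lemma gauss_curvature_coord u : D u ->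
  gauss_curvature F u = curvature_num (crd e1) (crd e2) (crd e3) u /
    metric_det (crd e1) (crd e2) (crd e3) u ^+ 2.
Proof.
move=> Du; rewrite /gauss_curvature first_form_det //.
set m := metric_det _ _ _ _; set w := cross (partial 0 F u) (partial 1 F u).
have mE : enorm w ^+ 2 = m.
  rewrite sqr_sqrtr; last by rewrite /dot sumr_ge0 // => i _; rewrite -expr2 sqr_ge0.
  pose g i j : R := dot (partial i F u) (partial j F u).
  have gE i j : first_form F u i j = g i j by rewrite mxE.
  have gC : g 1 0 = g 0 1 by exact: dotC.
  have -> : dot w w = g 0 0 * g 1 1 - g 0 1 ^+ 2 by exact: lagrange_identity.
  by clearbody g; rewrite /m -first_form_det // det_mx22 !gE gC expr2.
have sE i j : second_form F u i j =
    (enorm w)^-1 * normal_second (crd e1) (crd e2) (crd e3) i j u.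
  rewrite mxE /unit_normal -/w dotC [LHS](linearZ_LR (dot_lin _)) /= dotC.
  pose d i e : R := dot (partial i F u) e; pose d2 e : R := dot (partial i (partial j F) u) e.
  have p k e : partial k (crd e) u = d k e := partial_crd e k Du.
  have p2 e : partial i (partial j (crd e)) u = d2 e := partial2_crd e i j Du.
  have -> : dot (partial i (partial j F) u) w = d2 e1 * (d 0 e2 * d 1 e3 - d 0 e3 * d 1 e2) +
      d2 e2 * (d 0 e3 * d 1 e1 - d 0 e1 * d 1 e3) + d2 e3 * (d 0 e1 * d 1 e2 - d 0 e2 * d 1 e1).
    exact: (frame_triple fr).
  clearbody d d2; congr (_ * _).
  rewrite (normal_second_eq (p2 e1) (p2 e2) (p2 e3)
    (p 0 e1) (p 1 e1) (p 0 e2) (p 1 e2) (p 0 e3) (p 1 e3)).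
  by ring.
rewrite det_mx22 !sE /curvature_num.
move: (normal_second _ _ _ 0 0 u) (normal_second _ _ _ 1 1 u) (normal_second _ _ _ 0 1 u)
  (normal_second _ _ _ 1 0 u) => a b c d.
have -> : (enorm w)^-1 * a * ((enorm w)^-1 * b) - (enorm w)^-1 * c * ((enorm w)^-1 * d) =
  (enorm w ^+ 2)^-1 * (a * b - c * d) by rewrite expr2 invfM; ring.
by rewrite mE expr2 invfM; ring.
Qed.
End coordinates.

(** * Pieces that are graphs Z = f(X, Y), in arbitrary parameters *)

Section graph.
Variables (D E : set V) (X Y Z f : V -> R) (u : V).
Hypotheses (oD : open D) (oE : open E) (Du : D u).
Hypotheses (sX : smooth_on D X) (sY : smooth_on D Y) (sf : smooth_on E f).
Hypotheses (XYE : forall v, D v -> E (vec2 (X v) (Y v))).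
Hypotheses (ZE : forall v, D v -> Z v = f (vec2 (X v) (Y v))).

Let phi v := vec2 (X v) (Y v).

Let hp (D' : set V) (g : V -> R) i v : smooth_on D' g -> D' v ->
  has_partial i g v (partial i g v).
Proof. by move=> sg Dv; apply: has_partialP; exact: smooth_on_diff sg Dv. Qed.

Let pcomp (g : V -> R) i v : smooth_on E g -> D v ->
  has_partial i (fun w => g (phi w)) v
    (partial i X v * partial 0 g (phi v) + partial i Y v * partial 1 g (phi v)).
Proof.
move=> sg Dv.
have dX := smooth_on_diff sX Dv; have dY := smooth_on_diff sY Dv.
have dg := smooth_on_diff sg (XYE Dv).
split; last exact: partial_comp2.
exact: (differentiable_comp (differentiable_vec2 dX dY) dg).
Qed.

Let pZ i v : D v -> partial i Z v =
    partial i X v * partial 0 f (phi v) + partial i Y v * partial 1 f (phi v).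
Proof.
move=> Dv.
have ZE' : {in D, Z =1 fun w => f (phi w)} by move=> w /set_mem; exact: ZE.
by rewrite (eq_partial i oD ZE' (mem_set Dv)); exact: (pcomp i sf Dv).2.
Qed.

Let pZ2 i j : partial i (partial j Z) u =
  partial i (partial j X) u * partial 0 f (phi u) +
  partial j X u * (partial i X u * partial 0 (partial 0 f) (phi u) +
                   partial i Y u * partial 1 (partial 0 f) (phi u)) +
  (partial i (partial j Y) u * partial 1 f (phi u) +
  partial j Y u * (partial i X u * partial 0 (partial 1 f) (phi u) +
                   partial i Y u * partial 1 (partial 1 f) (phi u))).
Proof.
have pZ' : {in D, partial j Z =1 fun v =>
    partial j X v * partial 0 f (phi v) + partial j Y v * partial 1 f (phi v)}.
  by move=> w /set_mem; exact: pZ.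
rewrite (eq_partial i oD pZ' (mem_set Du)).
have sfi k := smooth_on_partial k sf.
exact: (has_partialD
  (has_partialM (hp i (smooth_on_partial j sX) Du) (pcomp i (sfi 0) Du))
  (has_partialM (hp i (smooth_on_partial j sY) Du) (pcomp i (sfi 1) Du))).2.
Qed.

Lemma graph_metric_det :
  metric_det X Y Z u = jac X Y u ^+ 2 * (1 + grad_sq f (phi u)).
Proof.
have alg (x0 x1 y0 y1 p q : R) :
    (x0 ^+ 2 + y0 ^+ 2 + (x0 * p + y0 * q) ^+ 2) * (x1 ^+ 2 + y1 ^+ 2 + (x1 * p + y1 * q) ^+ 2) -
    (x0 * x1 + y0 * y1 + (x0 * p + y0 * q) * (x1 * p + y1 * q)) ^+ 2 =
    (x0 * y1 - x1 * y0) ^+ 2 * (1 + (p ^+ 2 + q ^+ 2)) by ring.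
rewrite (metric_det_eq erefl erefl erefl erefl (pZ 0 Du) (pZ 1 Du)) /jac /grad_sq.
exact: alg.
Qed.

(** The second derivatives of X and Y enter along tangent vectors of the graph and drop out. What is
    left of the second form is the Hessian of f pulled back by (X, Y), times one factor J from the
    normal. The determinant thus gains J^2 from the pullback and J^2 from the normal. *)
Lemma graph_curvature_num :
  curvature_num X Y Z u = jac X Y u ^+ 4 * hess_det f (phi u).
Proof.
have alg1 (x0 x1 y0 y1 p q x y a b c d i0 i1 j0 j1 : R) :
    x * (y0 * (x1 * p + y1 * q) - (x0 * p + y0 * q) * y1) +
    y * ((x0 * p + y0 * q) * x1 - x0 * (x1 * p + y1 * q)) +
    (x * p + j0 * (i0 * a + i1 * b) + (y * q + j1 * (i0 * c + i1 * d))) * (x0 * y1 - y0 * x1) =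
    (x0 * y1 - x1 * y0) * (j0 * (i0 * a + i1 * b) + j1 * (i0 * c + i1 * d)) by ring.
have nE i j : normal_second X Y Z i j u = jac X Y u *
  (partial j X u * (partial i X u * partial 0 (partial 0 f) (phi u) +
                   partial i Y u * partial 1 (partial 0 f) (phi u)) +
   partial j Y u * (partial i X u * partial 0 (partial 1 f) (phi u) +
                   partial i Y u * partial 1 (partial 1 f) (phi u))).
  rewrite (normal_second_eq erefl erefl (pZ2 i j) erefl erefl erefl erefl (pZ 0 Du) (pZ 1 Du)).
  exact: alg1.
have alg2 (x0 x1 y0 y1 a b c d : R) : let J := x0 * y1 - x1 * y0 in
    J * (x0 * (x0 * a + y0 * b) + y0 * (x0 * c + y0 * d)) *
    (J * (x1 * (x1 * a + y1 * b) + y1 * (x1 * c + y1 * d))) -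
    J * (x1 * (x0 * a + y0 * b) + y1 * (x0 * c + y0 * d)) *
    (J * (x0 * (x1 * a + y1 * b) + y0 * (x1 * c + y1 * d))) =
    J ^+ 4 * (a * d - c * b) by move=> J; rewrite /J; ring.
rewrite /curvature_num (nE 0 0) (nE 1 1) (nE 0 1) (nE 1 0).
exact: alg2.
Qed.
End graph.

(** * Flatness where the projection to the plane is degenerate *)

Section degenerate.
Variables (D : set V) (X Y Z : V -> R) (u : V).
Hypotheses (oD : open D) (Du : D u).
Hypotheses (sX : smooth_on D X) (sY : smooth_on D Y).
Hypothesis J0 : forall v, D v -> jac X Y v = 0.

Let hp (g : V -> R) i v : smooth_on D g -> D v -> has_partial i g v (partial i g v).
Proof. by move=> sg Dv; apply: has_partialP; exact: smooth_on_diff sg Dv. Qed.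

(* If [al d0 + be d1] annihilates both [X] and [Y], then differentiating this relation
   shows that [(al, be)] lies in the kernel of the second form. *)
Let kernel (al be : V -> R) i : smooth_on D al -> smooth_on D be ->
  (forall v, D v -> al v * partial 0 X v + be v * partial 1 X v = 0) ->
  (forall v, D v -> al v * partial 0 Y v + be v * partial 1 Y v = 0) ->
  al u * normal_second X Y Z i 0 u + be u * normal_second X Y Z i 1 u =
  (al u * partial i (partial 0 Z) u + be u * partial i (partial 1 Z) u
   + partial i al u * partial 0 Z u + partial i be u * partial 1 Z u) * jac X Y u.
Proof.
move=> sal sbe kX kY.
have key (W : V -> R) : smooth_on D W ->
    (forall v, D v -> al v * partial 0 W v + be v * partial 1 W v = 0) ->
    al u * partial i (partial 0 W) u =
      - (be u * partial i (partial 1 W) u + partial i al u * partial 0 W u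
         + partial i be u * partial 1 W u).
  move=> sW kW.
  have kW' : {in D, (fun v => al v * partial 0 W v + be v * partial 1 W v) =1 fun=> 0}.
    by move=> v /set_mem; exact: kW.
  have alg (ai bi w0 w1 wi0 wi1 p q : R) : ai * w0 + p * wi0 + (bi * w1 + q * wi1) = 0 ->
      p * wi0 = - (q * wi1 + ai * w0 + bi * w1) by move=> *; lra.
  apply: alg; exact: has_partial_on oD Du kW' (has_partialD
    (has_partialM (hp i sal Du) (hp i (smooth_on_partial 0 sW) Du))
    (has_partialM (hp i sbe Du) (hp i (smooth_on_partial 1 sW) Du))) (has_partial_cst i u 0).
have alg (p q ai bi x0 x1 y0 y1 z0 z1 xi0 xi1 yi0 yi1 zi0 zi1 : R) :
    p * xi0 = - (q * xi1 + ai * x0 + bi * x1) -> p * yi0 = - (q * yi1 + ai * y0 + bi * y1) ->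
    p * (xi0 * (y0 * z1 - z0 * y1) + yi0 * (z0 * x1 - x0 * z1) + zi0 * (x0 * y1 - y0 * x1)) +
    q * (xi1 * (y0 * z1 - z0 * y1) + yi1 * (z0 * x1 - x0 * z1) + zi1 * (x0 * y1 - y0 * x1)) =
    (p * zi0 + q * zi1 + ai * z0 + bi * z1) * (x0 * y1 - x1 * y0).
  by move=> EX EY; rewrite !(mulrDr p) !(mulrA p) EX EY; ring.
exact: alg (key _ sX kX) (key _ sY kY).
Qed.

(** The fields (X_1, - X_0) and (Y_1, - Y_0) annihilate both X and Y because J = 0, so they lie in
    the kernel of the second form. If that form were nondegenerate at [u], both would vanish there,
    and with dX = dY = 0 the metric determinant would be zero. *)
Lemma degenerate_curvature : metric_det X Y Z u != 0 -> curvature_num X Y Z u = 0.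
Proof.
move=> m0.
have alg (a b n11 n10 n01 n00 : R) : n00 * n11 - n01 * n10 != 0 ->
    a * n00 + b * n01 = 0 -> a * n10 + b * n11 = 0 -> a = 0 /\ b = 0.
  move=> c0 E0 E1; split; apply: (mulIf c0); rewrite mul0r.
    transitivity ((a * n00 + b * n01) * n11 - (a * n10 + b * n11) * n01); first by ring.
    by rewrite E0 E1 !mul0r subrr.
  transitivity ((a * n10 + b * n11) * n00 - (a * n00 + b * n01) * n10); first by ring.
  by rewrite E0 E1 !mul0r subrr.
have key (al be : V -> R) : smooth_on D al -> smooth_on D be ->
    (forall v, D v -> al v * partial 0 X v + be v * partial 1 X v = 0) ->
    (forall v, D v -> al v * partial 0 Y v + be v * partial 1 Y v = 0) ->
    curvature_num X Y Z u != 0 -> al u = 0 /\ be u = 0.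
  move=> sal sbe kX kY c0; apply: alg c0 _ _.
    by rewrite (kernel 0 sal sbe kX kY) J0 // mulr0.
  by rewrite (kernel 1 sal sbe kX kY) J0 // mulr0.
have smN (g : V -> R) : smooth_on D g -> smooth_on D (fun v => -1 * g v).
  move=> sg; apply: smooth_algP => //.
  by apply: SmoothMul; [exact: SmoothCst|exact: SmoothBase].
have sX' i := smooth_on_partial i sX; have sY' i := smooth_on_partial i sY.
have swap (a b : R) : a * b + -1 * b * a = 0 by ring.
have swapJ (a b c d : R) : a * d - c * b = 0 -> c * b + -1 * a * d = 0 by move=> *; lra.
have swapJ' (a b c d : R) : a * d - c * b = 0 -> d * a + -1 * b * c = 0 by move=> *; lra.
apply/eqP; apply: contraNT m0 => c0.
have [x1 x0] := key _ _ (sX' 1) (smN _ (sX' 0)) (fun v _ => swap _ _)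
  (fun v Dv => swapJ _ _ _ _ (J0 Dv)) c0.
have [y1 y0] := key _ _ (sY' 1) (smN _ (sY' 0)) (fun v Dv => swapJ' _ _ _ _ (J0 Dv))
  (fun v _ => swap _ _) c0.
have neg0 (a : R) : -1 * a = 0 -> a = 0 by move=> *; lra.
have alg0 (z0 z1 : R) : (0 ^+ 2 + 0 ^+ 2 + z0 ^+ 2) * (0 ^+ 2 + 0 ^+ 2 + z1 ^+ 2) -
  (0 * 0 + 0 * 0 + z0 * z1) ^+ 2 = 0 by ring.
apply/eqP; rewrite (metric_det_eq (neg0 _ x0) x1 (neg0 _ y0) y1 erefl erefl).
exact: alg0.
Qed.
End degenerate.
End forms.

(** * Smoothness of rows, of the metric determinant and of the curvature *)

Section rows.
Context {R : realType}.
Notation V := 'rV[R]_2.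

Lemma smooth_on_row (n : nat) (D : set V) (F : V -> 'rV[R]_n) : open D ->
  (forall j, smooth_on D (fun v => F v 0 j : R)) -> smooth_on D F.
Proof.
move=> oD.
have dF (G : V -> 'rV[R]_n) u : (forall j, smooth_on D (fun v => G v 0 j : R)) -> D u ->
    differentiable G u.
  move=> sG Du.
  have -> : G = \sum_(j < n) (fun v => G v 0 j *: delta_mx 0 j).
    by apply/funext => v; rewrite fct_sumE; exact: row_sum_delta.
  apply: differentiable_sum => j; apply: differentiableZl.
  exact: smooth_on_diff (sG j) Du.
move=> sF0.
apply: (@smooth_on_coind _ 'rV[R]_n D (fun G : V -> 'rV[R]_n => forall j, smooth_on D (fun v => G v 0 j : R))) => //.
move=> G sG; split; first by move=> u; exact: dF.
move=> i; exists (partial i G) => // j.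
apply: eq_smooth_on (smooth_on_partial i (sG j)) => // v /set_mem Dv.
by rewrite partial_coord //; exact: dF.
Qed.

Lemma smooth_algB (D : set V) (f g : V -> R) : smooth_alg D f -> smooth_alg D g ->
  smooth_alg D (fun u => f u - g u).
Proof.
move=> sf sg; have -> : (fun u => f u - g u) = fun u => f u + -1 * g u.
  by apply/funext => u; rewrite mulN1r.
by apply: SmoothAdd => //; apply: SmoothMul => //; exact: SmoothCst.
Qed.

Lemma smooth_alg_sqr (D : set V) (f : V -> R) : smooth_alg D f ->
  smooth_alg D (fun u => f u ^+ 2).
Proof. by move=> sf; exact: SmoothMul. Qed.
Lemma smooth_alg_metric (D : set V) (X Y Z : V -> R) : smooth_on D X -> smooth_on D Y ->
  smooth_on D Z -> smooth_alg D (metric_det X Y Z).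
Proof.
move=> sX sY sZ.
have H (f : V -> R) i : smooth_on D f -> smooth_alg D (partial i f).
  by move=> sf; exact/SmoothBase/smooth_on_partial.
apply: smooth_algB.
  by apply: SmoothMul; do 2 (apply: SmoothAdd; last (by apply: smooth_alg_sqr; exact: H));
    apply: smooth_alg_sqr; exact: H.
apply: smooth_alg_sqr; apply: SmoothAdd; last by apply: SmoothMul; exact: H.
by apply: SmoothAdd; apply: SmoothMul; exact: H.
Qed.

Lemma smooth_alg_curvature_num (D : set V) (X Y Z : V -> R) : smooth_on D X -> smooth_on D Y ->
  smooth_on D Z -> smooth_alg D (curvature_num X Y Z).
Proof.
move=> sX sY sZ.
have H (f : V -> R) i : smooth_on D f -> smooth_alg D (partial i f).
  by move=> sf; exact/SmoothBase/smooth_on_partial.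
have H2 (f : V -> R) i j : smooth_on D f -> smooth_alg D (partial i (partial j f)).
  by move=> sf; exact/SmoothBase/smooth_on_partial/smooth_on_partial.
have HB (f g : V -> R) : smooth_on D f -> smooth_on D g -> smooth_alg D
    (fun u => partial 0 f u * partial 1 g u - partial 0 g u * partial 1 f u).
  by move=> sf sg; apply: smooth_algB; apply: SmoothMul; exact: H.
have HN i j : smooth_alg D (normal_second X Y Z i j).
  apply: SmoothAdd; last by apply: SmoothMul; [exact: H2|exact: HB].
  by apply: SmoothAdd; (apply: SmoothMul; [exact: H2|exact: HB]).
by apply: smooth_algB; apply: SmoothMul.
Qed.
End rows.

(** * Coordinate charts *)

Section charts.
Context {R : realType} {M : topologicalType}.
Notation V := 'rV[R]_2.

Lemma chart_image_open (phi : chart R M) (N : set M) :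
  is_chart phi -> open N -> open (cmap phi @` (cdom phi `&` N)).
Proof.
move=> [[od or] cK cc ic] oN; rewrite openE => _ [p [dp Np] <-].
have rp : cran phi (cmap phi p) by exists p.
have nr : \forall v \near cmap phi p, cran phi v by exact: open_nbhs_nbhs.
have nN : \forall v \near cmap phi p, N (cinv phi v).
  by apply: (ic _ rp); rewrite cK //; exact: open_nbhs_nbhs.
rewrite /interior; apply: filterS2 nr nN => v [q dq <-]; rewrite cK // => Nq.
by exists q.
Qed.

Lemma chart_preimage_open (phi : chart R M) (U : set V) :
  is_chart phi -> open U -> open (cdom phi `&` cmap phi @^-1` U).
Proof.
move=> [[od or] cK cc ic] oU; rewrite openE => p [dp Up].
apply: filterI; first exact: open_nbhs_nbhs.
by apply: (cc _ dp); exact: open_nbhs_nbhs.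
Qed.

Variable A : set (chart R M).
Hypothesis sM : smooth_surface A.

Definition smooth_fun (h : M -> R) : Prop :=
  forall psi, A psi -> smooth_on (cran psi) (h \o cinv psi).

Lemma atlas_chart phi : A phi -> is_chart phi.
Proof. by case: sM => _ _ + _ _; apply. Qed.

Lemma cran_open phi : A phi -> open (cran phi).
Proof. by move=> /atlas_chart[[]]. Qed.

Lemma cdom_open phi : A phi -> open (cdom phi).
Proof. by move=> /atlas_chart[[]]. Qed.

Lemma cinvK phi p : A phi -> cdom phi p -> cinv phi (cmap phi p) = p.
Proof. by move=> /atlas_chart[_ + _ _]; apply. Qed.

Lemma chart_at p : exists2 phi, A phi & cdom phi p.
Proof. by case: sM => _ _ _ + _; apply. Qed.

Lemma chart_continuous (phi : chart R M) (W : topologicalType) (h : M -> W) p :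
  A phi -> cdom phi p -> {for cmap phi p, continuous (h \o cinv phi)} ->
  {for p, continuous h}.
Proof.
move=> Aphi dp ch N; rewrite -{1}(cinvK Aphi dp) => nN.
have [_ _ cc _] := atlas_chart Aphi.
have n1 : \forall q \near p, N (h (cinv phi (cmap phi q))) := cc _ dp _ (ch _ nN).
have n2 : \forall q \near p, cdom phi q.
  by apply: open_nbhs_nbhs; split => //; exact: cdom_open.
suff : \forall q \near p, N (h q) by [].
by apply: filterS2 n1 n2 => q /= + dq; rewrite cinvK.
Qed.

Lemma smooth_fun_continuous h : smooth_fun h -> continuous h.
Proof.
move=> sh p; have [phi Aphi dp] := chart_at p.
apply: (chart_continuous Aphi dp); apply: differentiable_continuous.
by apply: smooth_on_diff (sh _ Aphi) _; exists p.
Qed.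

(** Used with (X, Y) to write the surface as a graph and with (X, Y - s) to match the model surface.
    The last clause transfers smooth functions on M to the new coordinates. *)
Theorem coordinate_chart (a b : M -> R) (N : set M) (phi : chart R M) (p : M) :
  smooth_fun a -> smooth_fun b -> open N -> N p -> A phi -> cdom phi p ->
  jac (a \o cinv phi) (b \o cinv phi) (cmap phi p) != 0 ->
  exists (g : chart R M) (r : R),
    [/\ smooth_chart A g, cdom g p /\ cdom g `<=` N,
        0 < r /\ cran g = ball (vec2 (a p) (b p)) r,
        cmap g = fun q => vec2 (a q) (b q) &
        forall h, smooth_fun h -> smooth_on (cran g) (h \o cinv g)].
Proof.
move=> sa sb oN Np Aphi dp J0; have cphi := atlas_chart Aphi.
have [[od or] cK cc ic] := cphi.
(* Restricting the old chart to [N] is what places the domain of the new one inside [N]. *)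
pose D := cmap phi @` (cdom phi `&` N).
have oD : open D by exact: chart_image_open.
have Dp : D (cmap phi p) by exists p.
have Dr : D `<=` cran phi by move=> _ [q [dq _] <-]; exists q.
pose a' := a \o cinv phi; pose b' := b \o cinv phi.
have sa' : smooth_on D a' by apply: smooth_onS Dr _; exact: sa.
have sb' : smooth_on D b' by apply: smooth_onS Dr _; exact: sb.
have [U [psi [r [r0 [oU Up UD _] Uphi psiP psis]]]] := inverse_function oD Dp sa' sb' J0.
have abp : vec2 (a' (cmap phi p)) (b' (cmap phi p)) = vec2 (a p) (b p).
  by rewrite /a' /b' /= cK.
rewrite abp in psiP psis Uphi.
pose B : set V := ball (vec2 (a p) (b p)) r.
pose g := Chart (cdom phi `&` cmap phi @^-1` U) (fun q => vec2 (a q) (b q)) (cinv phi \o psi).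
have abE q : cdom phi q -> vec2 (a' (cmap phi q)) (b' (cmap phi q)) = vec2 (a q) (b q).
  by move=> dq; rewrite /a' /b' /= cK.
have gran : cran g = B.
  apply/seteqP; split => [_ [q [dq Uq] <-]|v Bv] /=.
    by rewrite -abE //; exact: (Uphi _ Uq).1.
  have [Uv vE _] := psiP _ Bv; have [q [dq Nq] qE] := UD _ Uv.
  by exists q; [split => //=; rewrite qE|rewrite /= -abE // qE].
have psir v : B v -> cran phi (psi v).
  by move=> /psiP[/UD/Dr].
have oB : open B by exact: ball_open.
have cg : is_chart g.
  split.
  - by split; [exact: chart_preimage_open|rewrite gran].
  - by move=> q [dq Uq] /=; rewrite -abE // (Uphi _ Uq).2 cK.
  - move=> q [dq Uq] /=.
    apply: (@chart_continuous phi _ (fun q => vec2 (a q) (b q)) q) => //.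
    apply: differentiable_continuous.
    apply: (@differentiable_vec2 _ a' b'); [apply: smooth_on_diff sa' _|apply: smooth_on_diff sb' _];
      exact: UD.
  - move=> v; rewrite gran => Bv; have [_ _ dv] := psiP _ Bv.
    by apply: continuous_comp; [exact: differentiable_continuous|apply: ic; exact: psir].
have psi0 : smooth_on B (fun v => psi v 0 0 : R).
  by apply: (psis (fun v => v 0 0)); apply: smooth_algP => //; exact: SmoothCoord.
have psi1 : smooth_on B (fun v => psi v 0 1 : R).
  by apply: (psis (fun v => v 0 1)); apply: smooth_algP => //; exact: SmoothCoord.
exists g, r; split => //.
- split => // xi Axi; have cxi := atlas_chart Axi; split.
    have oT : open (cmap g @` (cdom g `&` cdom xi)).
      by apply: chart_image_open => //; exact: cdom_open.
    apply: smooth_on_row => // j.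
    pose h (v : V) : R := (cmap xi \o cinv phi) v 0 j.
    have sh : smooth_on (cmap phi @` (cdom phi `&` cdom xi)) h.
      apply: smooth_on_coord; first by apply: chart_image_open => //; exact: cdom_open.
      by case: sM => _ _ _ _; apply.
    rewrite (_ : (fun v => _) = fun v => h (vec2 (psi v 0 0) (psi v 0 1))); last first.
      by apply/funext => v; rewrite vec2K.
    have TB : cmap g @` (cdom g `&` cdom xi) `<=` B.
      by rewrite -gran => _ [q [dq _] <-]; exists q.
    apply: smooth_algP => //; apply: SmoothComp sh _ _ _.
    + by apply: SmoothBase; apply: smooth_onS psi0.
    + by apply: SmoothBase; apply: smooth_onS psi1.
    move=> _ [q [[dq Uq] dxq] <-]; rewrite vec2K /= -abE // (Uphi _ Uq).2.
    by exists q.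
  have oT : open (cmap xi @` (cdom xi `&` cdom g)).
    by apply: chart_image_open => //; case: cg => -[].
  have Txi : cmap xi @` (cdom xi `&` cdom g) `<=` cran xi.
    by move=> _ [q [dq _] <-]; exists q.
  by apply: smooth_on_vec2 => //; apply: smooth_onS Txi _; [exact: sa|exact: sb].
- by split => // q [dq Uq]; have [q' [dq' Nq'] /(congr1 (cinv phi))] := UD _ Uq;
    rewrite !cK // => <-.
- move=> h sh; rewrite gran.
  by apply: (psis (h \o cinv phi)); apply: smooth_onS (sh _ Aphi) => v /UD/Dr.
Qed.
End charts.

(** * Functions of x alone and coordinates on the plane *)

Section plane.
Context {R : realType}.

(** The difference quotient in direction y is identically zero, so this covers the arbitrary
    function that [area_invariant] provides. *)
Lemma partial_fst (G : R -> R) (u : 'rV[R]_2) : partial 1 (fun v => G (v 0 0)) u = 0.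
Proof.
have E : (fun h : R => h^-1 *: (G ((h *: delta_mx 0 1 + u) 0 0) - G (u 0 0))) = fun=> 0.
  by apply/funext => h; rewrite !mxE /= mulr0 add0r subrr scaler0.
by rewrite /partial /derive /= E; exact: lim_cst.
Qed.

Lemma plane_point_inj (o e1 e2 : 'rV[R]_3) (a b a' b' : R) : cartesian_frame e1 e2 ->
  plane_point o e1 e2 a b = plane_point o e1 e2 a' b' -> a = a'.
Proof.
move=> [e11 e22 e12] /(congr1 (fun w => dot (w - o) e1)).
have E (s t : R) : dot (plane_point o e1 e2 s t - o) e1 = s.
  rewrite /plane_point; rewrite -[X in X - _]addrA (addrC o) addrK -[LHS]/(dot_lin e1 _) linearD !linearZ /= e11.
  by rewrite (dotC e2) e12 /GRing.scale /= mulr1 mulr0 addr0.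
by rewrite !E.
Qed.
End plane.

(** * Surfaces with parallel contours and invariant area element *)

Section surface.
Context {R : realType} {M : topologicalType}.
Notation V := 'rV[R]_2.
Variables (A : set (chart R M)) (x : M -> 'rV[R]_3) (K : M -> R) (o e1 e2 : 'rV[R]_3).
Hypotheses (sM : smooth_surface A) (imm : smooth_immersion A x).
Hypotheses (gK : is_gauss_curvature A x K) (fr : cartesian_frame e1 e2).
Let e3 := cross e1 e2.

Let crd (e : 'rV[R]_3) (q : M) : R := dot (x q - o) e.
Let X := crd e1.
Let Y := crd e2.
Let Z := crd e3.

Lemma smooth_fun_crd e : smooth_fun A (fun q => dot (x q - o) e).
Proof.
move=> psi Apsi; apply: (@smooth_on_crd _ o (cran psi) (x \o cinv psi)).
  exact: (cran_open sM).
by have [] := imm Apsi.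
Qed.

(** The first form is the Gram matrix P P^T of a matrix with independent rows: v P P^T = 0 gives |v
    P|^2 = 0, hence v = 0. *)
Lemma first_form_det_neq0 phi u : A phi -> cran phi u ->
  \det (first_form (x \o cinv phi) u) != 0.
Proof.
move=> Aphi ru; have [_ /(_ u ru) free] := imm Aphi.
set P := (\matrix_(i < 2) _) in free.
have -> : first_form (x \o cinv phi) u = P *m P^T.
  by apply/matrixP => i j; rewrite !mxE /dot; apply: eq_bigr => k _; rewrite !mxE.
apply/negP => /det0P[v v0 vP].
have : dot (v *m P) (v *m P) = 0.
  transitivity (((v *m P) *m (v *m P)^T) 0 0).
    move: (v *m P) => w; rewrite [RHS]mxE /dot; apply: eq_bigr => k _.
    by rewrite [w^T _ _]mxE.
  by rewrite trmx_mul mulmxA -[v *m P *m P^T]mulmxA vP mul0mx mxE.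
rewrite /dot => /eqP; rewrite psumr_eq0; last by move=> k _; rewrite -expr2 sqr_ge0.
move=> /allP d0.
have /eqP : v *m P = 0.
  apply/rowP => k; rewrite [RHS]mxE; apply/eqP.
  by have := d0 k (mem_index_enum k); rewrite mulf_eq0 orbb.
by rewrite mulmx_free_eq0 // (negbTE v0).
Qed.

Definition metric_at (phi : chart R M) (q : M) : R :=
  metric_det (X \o cinv phi) (Y \o cinv phi) (Z \o cinv phi) (cmap phi q).

Definition jac_at (phi : chart R M) (q : M) : R :=
  jac (X \o cinv phi) (Y \o cinv phi) (cmap phi q).

Lemma metric_neq0 phi u : A phi -> cran phi u ->
  metric_det (X \o cinv phi) (Y \o cinv phi) (Z \o cinv phi) u != 0.
Proof.
move=> Aphi ru; have := first_form_det_neq0 Aphi ru.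
by rewrite (first_form_det o fr (imm Aphi).1 ru).
Qed.

Lemma curvature_chart phi u : A phi -> cran phi u ->
  K (cinv phi u) = curvature_num (X \o cinv phi) (Y \o cinv phi) (Z \o cinv phi) u /
    metric_det (X \o cinv phi) (Y \o cinv phi) (Z \o cinv phi) u ^+ 2.
Proof.
move=> Aphi ru; have [q dq qu] := ru; rewrite -qu (cinvK sM Aphi dq) (gK Aphi dq) qu.
exact: (gauss_curvature_coord o fr (cran_open sM Aphi) (imm Aphi).1 ru).
Qed.

Lemma smooth_fun_curvature : smooth_fun A K.
Proof.
move=> phi Aphi; have orr := cran_open sM Aphi.
have sX := smooth_fun_crd e1 Aphi; have sY := smooth_fun_crd e2 Aphi.
have sZ := smooth_fun_crd e3 Aphi.
apply: (@eq_smooth_on _ _ _ (fun u => curvature_num (X \o cinv phi) (Y \o cinv phi) (Z \o cinv phi) u *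
    (metric_det (X \o cinv phi) (Y \o cinv phi) (Z \o cinv phi) u ^+ 2)^-1)) => //.
  by move=> u /set_mem ru; rewrite /= curvature_chart.
apply: smooth_algP => //; apply: SmoothMul; first exact: smooth_alg_curvature_num.
apply: SmoothInv; first by apply: smooth_alg_sqr; exact: smooth_alg_metric.
by move=> u ru; rewrite expf_neq0 //; exact: metric_neq0.
Qed.

Lemma flat_of_degenerate phi p (N : set M) : A phi -> cdom phi p -> open N -> N p ->
  (forall q, cdom phi q -> N q -> jac_at phi q = 0) -> K p = 0.
Proof.
move=> Aphi dp oN Np J0.
have rp : cran phi (cmap phi p) by exists p.
pose D := cmap phi @` (cdom phi `&` N).
have oD : open D by apply: chart_image_open => //; exact: (atlas_chart sM).
have Dr : D `<=` cran phi by move=> _ [q [dq _] <-]; exists q.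
have Dp : D (cmap phi p) by exists p.
rewrite -{1}(cinvK sM Aphi dp) (curvature_chart Aphi rp).
rewrite (@degenerate_curvature _ D) ?mul0r //.
- by apply: smooth_onS Dr _; exact: smooth_fun_crd.
- by apply: smooth_onS Dr _; exact: smooth_fun_crd.
- by move=> _ [q [dq Nq] <-]; exact: J0.
- exact: metric_neq0.
Qed.

(** The squared gradient length of (a / k) exp (k x) cos (k y) at x = [X q]. *)
Definition profile (k a : R) (q : M) : R := (a * expR (k * X q)) ^+ 2.

(** The relations between curvature, area element and [X] that hold on the model
    surface with parameters [k] and [c = a / k]. *)
Definition normal_form (k a : R) (q : M) : Prop :=
  K q = - (k ^+ 2 * profile k a q) / (1 + profile k a q) ^+ 2 /\
  forall psi, A psi -> cdom psi q ->
    metric_at psi q = jac_at psi q ^+ 2 * (1 + profile k a q).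

(** * A chart with coordinates (X, Y) whose range is a ball *)

Section graph_chart.
Variables (g : chart R M) (u0 : V) (r : R).
Let B : set V := ball u0 r.
Hypotheses (sg : smooth_chart A g) (r0 : 0 < r) (gran : cran g = B).
Hypothesis gmap : cmap g = fun q => vec2 (X q) (Y q).
Hypothesis gs : forall h, smooth_fun A h -> smooth_on (cran g) (h \o cinv g).
Let f : V -> R := Z \o cinv g.

Let oB : open B. Proof. exact: ball_open. Qed.

Let gcinvK q : cdom g q -> cinv g (cmap g q) = q.
Proof. by case: sg => -[_ + _ _] _; apply. Qed.

Let gB v : B v -> cdom g (cinv g v) /\ vec2 (X (cinv g v)) (Y (cinv g v)) = v.
Proof.
rewrite -gran => -[q dq qv]; rewrite -qv gcinvK //; split => //.
by rewrite gmap.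
Qed.

Let gX v : B v -> X (cinv g v) = v 0 0.
Proof. by move=> /gB[_ {2}<-]; rewrite vec2_0. Qed.

Let gY v : B v -> Y (cinv g v) = v 0 1.
Proof. by move=> /gB[_ {2}<-]; rewrite vec2_1. Qed.

Let gq q : cdom g q -> B (vec2 (X q) (Y q)) /\ Z q = f (vec2 (X q) (Y q)).
Proof.
move=> dq; have E : vec2 (X q) (Y q) = cmap g q by rewrite gmap.
by rewrite E /f /= gcinvK //; split => //; rewrite -gran; exists q.
Qed.

Let sf : smooth_on B f.
Proof. by rewrite -gran; apply: gs; exact: smooth_fun_crd. Qed.

Let sK : smooth_on B (K \o cinv g).
Proof. by rewrite -gran; apply: gs; exact: smooth_fun_curvature. Qed.

Let smooth_x : smooth_on B (x \o cinv g).
Proof.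
apply: smooth_on_row => // j; rewrite -gran; apply: (gs (h := fun q => x q 0 j)).
move=> psi Apsi; apply: (smooth_on_coord (F := x \o cinv psi)).
  exact: (cran_open sM).
by have [] := imm Apsi.
Qed.

(** The relations are read in a chart [psi] of [A], where K and the immersion condition are given;
    [g] is only known to lie in the maximal atlas. *)
Lemma graph_relations psi q : A psi -> cdom psi q -> cdom g q ->
  let v := vec2 (X q) (Y q) in
  [/\ metric_at psi q = jac_at psi q ^+ 2 * (1 + grad_sq f v),
      jac_at psi q != 0 & K q = hess_det f v / (1 + grad_sq f v) ^+ 2].
Proof.
move=> Apsi dq gdq v.
have og : open (cdom g) by case: sg => -[[]].
pose D := cmap psi @` (cdom psi `&` cdom g).
have oD : open D by apply: chart_image_open => //; exact: (atlas_chart sM).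
have Dr : D `<=` cran psi by move=> _ [q' [dq' _] <-]; exists q'.
have Dq : D (cmap psi q) by exists q.
have rq := Dr _ Dq.
have sX : smooth_on D (X \o cinv psi) by apply: smooth_onS Dr _; exact: smooth_fun_crd.
have sY : smooth_on D (Y \o cinv psi) by apply: smooth_onS Dr _; exact: smooth_fun_crd.
have XYB w : D w -> B (vec2 ((X \o cinv psi) w) ((Y \o cinv psi) w)).
  by move=> [q' [dq' gdq'] <-]; rewrite /= (cinvK sM) //; have [] := gq gdq'.
have ZE w : D w -> (Z \o cinv psi) w = f (vec2 ((X \o cinv psi) w) ((Y \o cinv psi) w)).
  by move=> [q' [dq' gdq'] <-]; rewrite /= (cinvK sM) //; have [] := gq gdq'.
have m := graph_metric_det oD Dq sX sY sf XYB ZE.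
have c := graph_curvature_num oD Dq sX sY sf XYB ZE.
have vE : vec2 ((X \o cinv psi) (cmap psi q)) ((Y \o cinv psi) (cmap psi q)) = v.
  by rewrite /= (cinvK sM).
rewrite vE in m c.
have m0 := metric_neq0 Apsi rq.
have j0 : jac_at psi q != 0.
  by apply: contra m0 => /eqP j0; rewrite m -/(jac_at psi q) j0 expr0n mul0r.
split => //.
rewrite -{1}(cinvK sM Apsi dq) (curvature_chart Apsi rq) m c -/(jac_at psi q).
have alg (J G H : R) : J != 0 -> 1 + G != 0 ->
  J ^+ 4 * H / (J ^+ 2 * (1 + G)) ^+ 2 = H / (1 + G) ^+ 2.
  by move=> J0 G0; field; rewrite J0 G0.
apply: alg => //; rewrite gt_eqF // ltr_wpDr //.
by rewrite addr_ge0 ?sqr_ge0.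
Qed.

(** In the coordinates (X, Y) themselves the Jacobian is 1. *)
Lemma graph_area v : B v -> area_density (x \o cinv g) v = Num.sqrt (1 + grad_sq f v).
Proof.
move=> Bv; rewrite /area_density (first_form_det o fr smooth_x Bv); congr Num.sqrt.
have sX : smooth_on B (X \o cinv g) by rewrite -gran; apply: gs; exact: smooth_fun_crd.
have sY : smooth_on B (Y \o cinv g) by rewrite -gran; apply: gs; exact: smooth_fun_crd.
have XE w : B w -> vec2 ((X \o cinv g) w) ((Y \o cinv g) w) = w.
  by move=> Bw; have [] := gB Bw.
have XYB w : B w -> B (vec2 ((X \o cinv g) w) ((Y \o cinv g) w)) by move=> Bw; rewrite XE.
have ZE w : B w -> (Z \o cinv g) w = f (vec2 ((X \o cinv g) w) ((Y \o cinv g) w)).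
  by move=> Bw; rewrite XE.
have m := graph_metric_det oB Bv sX sY sf XYB ZE.
rewrite XE // in m; rewrite [LHS]m.
have X0 : {in B, X \o cinv g =1 fun w => w 0 0} by move=> w /set_mem; exact: gX.
have Y0 : {in B, Y \o cinv g =1 fun w => w 0 1} by move=> w /set_mem; exact: gY.
have pX i : partial i (X \o cinv g) v = (i == 0)%:R.
  by rewrite (eq_partial i oB X0 (mem_set Bv)) partial_coord_id.
have pY i : partial i (Y \o cinv g) v = (i == 1)%:R.
  by rewrite (eq_partial i oB Y0 (mem_set Bv)) partial_coord_id.
rewrite /jac (pX 0) (pX 1) (pY 0) (pY 1) /=.
by rewrite mulr1 mul0r subr0 expr1n mul1r.
Qed.

Hypothesis inv : area_invariant A x o e1 e2.

Lemma grad_sq_invariant v : B v -> partial 1 (grad_sq f) v = 0.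
Proof.
move=> Bv.
have gproj p : cdom g p ->
    plane_proj o e1 e2 (x p) = plane_point o e1 e2 (cmap g p 0 0) (cmap g p 0 1).
  by move=> _; rewrite gmap vec2_0 vec2_1.
have [|G nG] := inv sg gproj (u := v); first by rewrite gran.
have nB : \forall w \near v, B w by exact: open_nbhs_nbhs.
have nE : \forall w \near v, grad_sq f w = G (w 0 0) ^+ 2 - 1.
  apply: filterS2 nG nB => w + Bw; rewrite graph_area // => <-.
  by rewrite sqr_sqrtr; [rewrite addrC addKr|rewrite !addr_ge0 // ?sqr_ge0].
rewrite /partial (near_eq_derive _ nE).
exact: (partial_fst (fun t => G t ^+ 2 - 1)).
Qed.

Hypothesis par : parallel_K_contours x K o e1 e2.

(* Otherwise the level set of [K] through the point is locally a curve along which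
   [X] varies. *)
Lemma curvature_invariant v : B v -> partial 1 (K \o cinv g) v = 0.
Proof.
move=> Bv; apply/eqP; apply/negP => /negP k1.
pose a (w : V) : R := w 0 0; pose k := K \o cinv g.
have sa : smooth_on B a by apply: smooth_algP => //; exact: SmoothCoord.
have J0 : jac a k v != 0.
  have alg (c d : R) : d != 0 -> 1 * d - 0 * c != 0 by rewrite mul1r mul0r subr0.
  by rewrite /jac (partial_coord_id 0 0) (partial_coord_id 1 0); exact: alg.
have [U [psi [s [s0 [oU Uv UB _] Uphi psiP _]]]] := inverse_function oB Bv sa sK J0.
pose I := [set t : R | `|v 0 0 - t| < s].
(* In the local coordinates (x, K) this is the line on which K keeps its value at [v], parametrized
   by x. *)
pose c (t : R) : M := cinv g (psi (vec2 t (k v))).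
have Ib t : I t -> ball (vec2 (a v) (k v)) s (vec2 t (k v)).
  move=> It; rewrite -ball_normE /=; apply: le_lt_trans It.
  apply: norm_le_coord => //; rewrite !mxE //=.
  by rewrite subrr normr0.
have cP t : I t -> X (c t) = t /\ K (c t) = k v.
  move=> /Ib/psiP[/UB Bp pE _].
  have p0 : psi (vec2 t (k v)) 0 0 = t.
    by have := congr1 (fun w : V => w 0 0) pE; rewrite !vec2_0.
  have p1 : K (cinv g (psi (vec2 t (k v)))) = k v.
    by have := congr1 (fun w : V => w 0 1) pE; rewrite !vec2_1.
  by rewrite /c gX.
have Iv : I (v 0 0) by rewrite /I /= subrr normr0.
have cv : c (v 0 0) = cinv g v by rewrite /c (Uphi v Uv).2.
have conI : connected (c @` I).
  apply: connected_continuous_connected.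
    apply/connected_intervalP => t1 t2 I1 I2 t /andP[t1t tt2].
    by move: I1 I2; rewrite /I /= !ltr_distlC => /andP[? ?] /andP[? ?]; apply/andP; split; lra.
  apply: continuous_in_subspaceT => t /set_mem It.
  have [/UB Bp pE dpsi] := psiP _ (Ib t It).
  apply: (@continuous_comp _ _ _ (fun t => psi (vec2 t (k v))) (cinv g)); last first.
    by case: sg => -[_ _ _ +] _; apply; rewrite gran.
  apply: (@continuous_comp _ _ _ (fun t => vec2 t (k v)) psi); last exact: differentiable_continuous.
  have -> : (fun t : R => vec2 t (k v)) = fun t => t *: delta_mx 0 0 + k v *: delta_mx 0 1.
    by apply/funext => t'; exact: vec2E.
  by apply: continuousD; [exact: scalel_continuous|exact: cst_continuous].
(* The arc is connected, so it stays in one component of the contour and projects into a single line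
   x = b, although x varies along it. *)
have [b bP] := par (erefl (K (cinv g v))).
have Xb t : I t -> t = b.
  move=> It.
  have [ct kt] := cP t It.
  have : coord_line o e1 e2 b (plane_proj o e1 e2 (x (c t))).
    apply: bP; exists (c t) => //.
    have Bx : (c @` I) (cinv g v) by exists (v 0 0).
    have BA : c @` I `<=` K_contour K (K (cinv g v)) by move=> _ [t' /cP[_ kt'] <-].
    by apply: (connected_component_max Bx BA conI); exists t.
  by move=> [y _ /(plane_point_inj fr) ->].
have I2 : I (v 0 0 + s / 2).
  by rewrite /I /= opprD addrA subrr add0r normrN gtr0_norm ?divr_gt0 //; lra.
by have := Xb _ I2; rewrite -(Xb _ Iv); lra.
Qed.

Lemma curvature_graph v : B v -> K (cinv g v) = hess_det f v / (1 + grad_sq f v) ^+ 2.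
Proof.
move=> Bv; have [dv vE] := gB Bv; have [psi Apsi dpsi] := chart_at sM (cinv g v).
by have [_ _ ->] := graph_relations Apsi dpsi dv; rewrite vE.
Qed.

Lemma hess_det_curvature v : B v ->
  hess_det f v = K (cinv g v) * ((1 + grad_sq f v) * (1 + grad_sq f v)).
Proof.
move=> Bv; rewrite curvature_graph // -expr2 divfK // expf_neq0 // gt_eqF //.
by rewrite ltr_wpDr // addr_ge0 ?sqr_ge0.
Qed.

Lemma hess_det_invariant v : B v -> partial 1 (hess_det f) v = 0.
Proof.
move=> Bv.
have E : {in B, hess_det f =1 fun w => (K \o cinv g) w *
    ((1 + grad_sq f w) * (1 + grad_sq f w))}.
  by move=> w /set_mem Bw; exact: hess_det_curvature.
rewrite (eq_partial 1 oB E (mem_set Bv)).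
have pK : has_partial 1 (K \o cinv g) v 0.
  by split; [exact: smooth_on_diff sK Bv|exact: curvature_invariant].
have sgr : smooth_on B (grad_sq f).
  apply: smooth_algP => //.
  by apply: SmoothAdd; apply: smooth_alg_sqr; exact/SmoothBase/smooth_on_partial.
have pG : has_partial 1 (grad_sq f) v 0.
  by split; [exact: smooth_on_diff sgr Bv|exact: grad_sq_invariant].
have pG1 := has_partialD (has_partial_cst 1 v 1) pG.
rewrite (has_partialM pK (has_partialM pG1 pG1)).2.
by rewrite /= !(mul0r, mulr0, addr0, add0r).
Qed.

Lemma graph_local_form : (forall q, cdom g q -> K q != 0) ->
  exists k a s d : R, [/\ k != 0, 0 < a & forall q, cdom g q ->
    Z q = a / k * expR (k * X q) * cos (k * (Y q - s)) + d /\ normal_form k a q].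
Proof.
move=> K0.
have H0 v : B v -> hess_det f v != 0.
  move=> Bv; have [dv _] := gB Bv; apply: contra (K0 _ dv) => /eqP h0.
  by rewrite curvature_graph // h0 mul0r.
have [k [a [s [d [k0 a0 kP]]]]] :=
  graph_pde_solution r0 sf grad_sq_invariant hess_det_invariant H0.
exists k, a, s, d; split => // q dq.
have [Bq Zq] := gq dq; have [fq gq' hq] := kP _ Bq.
rewrite vec2_0 in fq gq'; rewrite vec2_1 in fq.
split; first by rewrite Zq fq.
have [psi Apsi dpsi] := chart_at sM q.
split.
  have [_ _ ->] := graph_relations Apsi dpsi dq.
  by rewrite hq gq'.
move=> xi Axi dxi; have [-> _ _] := graph_relations Axi dxi dq.
by rewrite gq'.
Qed.
End graph_chart.

Hypotheses (par : parallel_K_contours x K o e1 e2) (inv : area_invariant A x o e1 e2).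

Lemma curvature_neq0_open : open [set q | K q != 0].
Proof.
rewrite openE => q Kq.
suff : \forall q' \near q, K q' != 0 by [].
have cK : {for q, continuous K} := smooth_fun_continuous sM smooth_fun_curvature (x := q).
by move: cK => /cvgr_neq0; apply.
Qed.

Lemma local_form psi p : A psi -> cdom psi p -> jac_at psi p != 0 -> K p != 0 ->
  exists (O : set M) (k a s d : R), [/\ open O /\ O p, k != 0, 0 < a & forall q, O q ->
    Z q = a / k * expR (k * X q) * cos (k * (Y q - s)) + d /\ normal_form k a q].
Proof.
move=> Apsi dp J0 K0.
have oN := curvature_neq0_open.
have [g [r [sg [gp gN] [r0 gran] gmap gs]]] := coordinate_chart sM (smooth_fun_crd e1)
  (smooth_fun_crd e2) oN K0 Apsi dp J0.
have [k [a [s [d [k0 a0 gP]]]]] := graph_local_form sg r0 gran gmap gs inv par gN.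
exists (cdom g), k, a, s, d; split => //; split => //.
by case: sg => -[[]].
Qed.

Lemma profile_gt0 k a q : 0 < a -> 0 < profile k a q.
Proof. by move=> a0; rewrite exprn_gt0 // mulr_gt0 // expR_gt0. Qed.

Lemma normal_form_regular k a q psi : k != 0 -> 0 < a -> normal_form k a q ->
  A psi -> cdom psi q -> jac_at psi q != 0 /\ K q != 0.
Proof.
move=> k0 a0 [Kq mq] Apsi dq; have w0 := profile_gt0 k q a0.
split.
  have rq : cran psi (cmap psi q) by exists q.
  apply: contra (metric_neq0 Apsi rq) => /eqP j0.
  by rewrite -/(metric_at psi q) mq // j0 expr0n mul0r.
rewrite Kq; apply: mulf_neq0.
  by rewrite oppr_eq0; apply: mulf_neq0; [exact: expf_neq0|exact: lt0r_neq0].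
by rewrite invr_eq0 expf_neq0 // gt_eqF // addr_gt0.
Qed.

(** Cancelling the squared Jacobian gives a exp (k X) = a' exp (k' X) near [p]. If k and k'
    differed, X would be constant near [p] and the Jacobian would vanish. *)
Lemma normal_form_unique (O : set M) p k a k' a' : open O -> O p -> k != 0 -> 0 < a -> 0 < a' ->
  (forall q, O q -> normal_form k a q) -> (forall q, O q -> normal_form k' a' q) ->
  k = k' /\ a = a'.
Proof.
move=> oO Op k0 a0 a'0 nf nf'.
have [phi Aphi dp] := chart_at sM p.
have pE q : O q -> cdom phi q -> a * expR (k * X q) = a' * expR (k' * X q).
  move=> Oq dq; have [J0 _] := normal_form_regular k0 a0 (nf _ Oq) Aphi dq.
  have [_ /(_ phi Aphi dq) m] := nf _ Oq; have [_ /(_ phi Aphi dq)] := nf' _ Oq.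
  rewrite m => /(mulfI (expf_neq0 2 J0))/addrI/eqP.
  by rewrite eqrXn2 ?mulr_ge0 ?expR_ge0 ?(ltW a0) ?(ltW a'0) // => /eqP.
suff kk : k = k'.
  split => //; have := pE _ Op dp; rewrite kk => /mulIf; apply.
  by rewrite gt_eqF // expR_gt0.
apply/eqP; apply: contraT => kk'.
have [J0 _] := normal_form_regular k0 a0 (nf _ Op) Aphi dp.
have Xc q : O q -> cdom phi q -> X q = X p.
  have E q' : O q' -> cdom phi q' -> expR ((k - k') * X q') = a' / a.
    move=> Oq dq; have := pE _ Oq dq; rewrite mulrBl expRD expRN => H.
    have e0 := expR_gt0 (k' * X q').
    rewrite -[LHS](mulKf (lt0r_neq0 a0)) (mulrA a) H mulfK ?lt0r_neq0 //.
    by rewrite mulrC.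
  move=> Oq dq; have := E _ Oq dq; rewrite -(E _ Op dp) => /expR_inj/mulfI; apply.
  by rewrite subr_eq0.
pose D := cmap phi @` (cdom phi `&` O).
have oD : open D by apply: chart_image_open => //; exact: (atlas_chart sM).
have Dp : D (cmap phi p) by exists p.
have XD : {in D, X \o cinv phi =1 fun=> X p}.
  by move=> _ /set_mem[q [dq Oq] <-] /=; rewrite (cinvK sM) // Xc.
have pX i : partial i (X \o cinv phi) (cmap phi p) = 0.
  by rewrite (eq_partial i oD XD (mem_set Dp)) partial_cst.
by move: J0; rewrite /jac_at /jac (pX 0) (pX 1) !mul0r subrr eqxx.
Qed.

Lemma regular_point (p0 : M) :
  (forall O : set M, open O -> O !=set0 -> ~ (forall p, O p -> grad_vanishes_at A x K p)) ->
  exists phi p, [/\ A phi, cdom phi p, jac_at phi p != 0 & K p != 0].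
Proof.
move=> nograd; apply: contrapT => noreg.
have K0 p : K p = 0.
  apply/eqP; apply: contraT => Kp; have [phi Aphi dp] := chart_at sM p.
  move: (Kp); rewrite (flat_of_degenerate Aphi dp curvature_neq0_open Kp) ?eqxx // => q dq Kq.
  apply/eqP; apply: contraT => Jq; exfalso; apply: noreg.
  by exists phi, q.
(* K is now identically zero, so M itself is an open set on which the gradient vanishes. *)
apply: (nograd setT openT); first by exists p0.
move=> p _ phi Aphi dp; rewrite /gradient.
have -> : K \o cinv phi = fun=> 0 by apply/funext => u; exact: K0.
rewrite (_ : (\row_i _) = 0) ?mul0mx //.
by apply/rowP => i; rewrite !mxE; exact: partial_cst.
Qed.

Lemma zero_on_closure (S : set M) phi q (G : V -> R) : A phi -> cdom phi q -> closure S q ->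
  {for cmap phi q, continuous G} -> (forall r, S r -> cdom phi r -> G (cmap phi r) = 0) ->
  G (cmap phi q) = 0.
Proof.
move=> Aphi dq clS cG G0; apply/eqP; apply: contraT => Gq.
have [_ _ cc _] := atlas_chart sM Aphi.
have nG : \forall v \near cmap phi q, G v != 0 by move: cG => /cvgr_neq0; apply.
have n1 : \forall r \near q, G (cmap phi r) != 0 := cc _ dq _ nG.
have n2 : \forall r \near q, cdom phi r.
  by apply: open_nbhs_nbhs; split => //; exact: (cdom_open sM).
have [r [Sr [Gr dr]]] := clS _ (filterI n1 n2).
by move: Gr; rewrite /= G0 // eqxx.
Qed.

(** Each relation says that a function continuous in a chart vanishes; the denominator (1 + w)^2 is
    positive everywhere. *)
Lemma normal_form_closure (S : set M) k a q : 0 < a -> closure S q ->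
  (forall r, S r -> normal_form k a r) -> normal_form k a q.
Proof.
move=> a0 clS nf.
have dw phi u : A phi -> cran phi u -> differentiable (profile k a \o cinv phi) u.
  move=> Aphi ru; have dX := smooth_on_diff (smooth_fun_crd e1 Aphi) ru.
  have pX := has_partialM (has_partial_cst 0 u k) (has_partialP 0 dX).
  have pe := has_partial_comp1 (is_derive_expR _) pX.
  have pae := has_partialM (has_partial_cst 0 u a) pe.
  exact: (has_partialM pae pae).1.
split.
  have [phi Aphi dq] := chart_at sM q.
  pose G u := K (cinv phi u) - - (k ^+ 2 * profile k a (cinv phi u)) / (1 + profile k a (cinv phi u)) ^+ 2.
  have rq : cran phi (cmap phi q) by exists q.
  have : G (cmap phi q) = 0.
    apply: (zero_on_closure Aphi dq clS).
      apply: differentiable_continuous; have dwq := dw _ _ Aphi rq.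
      have d1w : differentiable (fun u => 1 + profile k a (cinv phi u)) (cmap phi q).
        by apply: differentiableD; [exact: differentiable_cst|exact: dwq].
      apply: differentiableB; first exact: smooth_on_diff (smooth_fun_curvature Aphi) rq.
      apply: differentiableM.
        by apply: differentiableN; apply: differentiableM; [exact: differentiable_cst|exact: dwq].
      apply: differentiableV; first exact: (@differentiableM _ _ _ _ _ d1w d1w).
      by rewrite expf_neq0 // lt0r_neq0 // addr_gt0 // profile_gt0.
    by move=> r Sr dr; rewrite /G (cinvK sM) // (nf _ Sr).1 subrr.
  by rewrite /G (cinvK sM) // => /eqP; rewrite subr_eq0 => /eqP.
move=> phi Aphi dq.
have rq : cran phi (cmap phi q) by exists q.
pose Gm := metric_det (X \o cinv phi) (Y \o cinv phi) (Z \o cinv phi).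
pose Gj := jac (X \o cinv phi) (Y \o cinv phi).
pose G u := Gm u - Gj u ^+ 2 * (1 + profile k a (cinv phi u)).
have sX := smooth_fun_crd e1 Aphi; have sY := smooth_fun_crd e2 Aphi.
have sZ := smooth_fun_crd e3 Aphi.
have : G (cmap phi q) = 0.
  apply: (zero_on_closure Aphi dq clS).
    apply: differentiable_continuous; have dwq := dw _ _ Aphi rq.
    have dj : differentiable Gj (cmap phi q).
      by apply: smooth_on_diff (smooth_jac (cran_open sM Aphi) sX sY) rq.
    apply: differentiableB.
      by apply: smooth_alg_diff rq; exact: smooth_alg_metric.
    apply: differentiableM; first exact: (@differentiableM _ _ _ _ _ dj dj).
    by apply: differentiableD; [exact: differentiable_cst|exact: dwq].
  move=> r Sr dr; rewrite /G (cinvK sM) // /Gm -/(metric_at phi r) ((nf _ Sr).2 _ Aphi dr).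
  by rewrite -/(jac_at phi r) subrr.
by rewrite /G (cinvK sM) // => /eqP; rewrite subr_eq0 => /eqP.
Qed.

Lemma global_normal_form phi0 p0 : connected [set: M] ->
  A phi0 -> cdom phi0 p0 -> jac_at phi0 p0 != 0 -> K p0 != 0 ->
  exists k a : R, [/\ k != 0, 0 < a & forall q, normal_form k a q].
Proof.
move=> conM A0 dp0 J0 K0.
have [Q [k [a [s [d [[oQ Qp] k0 a0 nf]]]]]] := local_form A0 dp0 J0 K0.
exists k, a; split => //.
(* Requiring the relations on a neighbourhood makes [S] open by construction. At a limit point they
   persist, so the point is regular and has a local form with its own parameters; its neighbourhood
   meets [S], and uniqueness on the overlap identifies the parameters. *)
pose S := [set q | exists Q' : set M, [/\ open Q', Q' q & forall r, Q' r -> normal_form k a r]].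
have Snf q : S q -> normal_form k a q by move=> [Q' [_ Q'q]]; apply.
have oS : open S.
  rewrite openE => q [Q' [oQ' Q'q nf']].
  by apply: filterS (open_nbhs_nbhs (conj oQ' Q'q)) => r Q'r; exists Q'.
have cS : closed S.
  move=> q clS; have nfq := normal_form_closure a0 clS Snf.
  have [phi Aphi dq] := chart_at sM q.
  have [Jq Kq] := normal_form_regular k0 a0 nfq Aphi dq.
  have [Q2 [k2 [a2 [s2 [d2 [[oQ2 Q2q] k20 a20 nf2]]]]]] := local_form Aphi dq Jq Kq.
  have [r [[Q3 [oQ3 Q3r nf3]] Q2r]] := clS _ (open_nbhs_nbhs (conj oQ2 Q2q)).
  have [| | | |kE aE] := @normal_form_unique (Q3 `&` Q2) r k a k2 a2 _ _ k0 a0 a20.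
  - exact: openI.
  - by split.
  - by move=> t [/nf3].
  - by move=> t [_ /nf2[]].
  by exists Q2; split => // t /nf2[_]; rewrite -kE -aE.
have ST : S = [set: M].
  apply: conM; first by exists p0, Q; split => // r /nf[].
    by exists S => //; rewrite setTI.
  by exists S => //; rewrite setTI.
by move=> q; apply: Snf; rewrite ST.
Qed.

Lemma model_chart k a p : k != 0 -> 0 < a -> (forall q, normal_form k a q) ->
  exists phi : chart R M, [/\ smooth_chart A phi, cdom phi p &
    exists (T : 'M[R]_3) (b : 'rV[R]_3), [/\ T *m T^T = 1%:M, \det T = 1 &
      forall q, cdom phi q -> x q *m T + b = p_surface k (a / k) (cmap phi q)]].
Proof.
move=> k0 a0 nf; have [phi Aphi dp] := chart_at sM p.
have [Jp Kp] := normal_form_regular k0 a0 (nf p) Aphi dp.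
have [Q [k' [a' [s [d [[oQ Qp] k'0 a'0 lf]]]]]] := local_form Aphi dp Jp Kp.
(* The local form brings its own parameters; uniqueness identifies them with [k] and [a], leaving
   only [s] and [d] specific to this neighbourhood. *)
have [kE aE] := normal_form_unique oQ Qp k0 a0 a'0 (fun q _ => nf q) (fun q Qq => (lf q Qq).2).
rewrite -{}kE -{}aE {k' a' k'0 a'0} in lf.
(* Y - s is the second coordinate for the origin moved to [o + s *: e2], so it is smooth for the
   same reason as Y. *)
have YsE : (fun q => Y q - s) = fun q => dot (x q - (o + s *: e2)) e2.
  apply/funext => q; rewrite opprD addrA -[RHS]/(dot_lin e2 _) linearB linearZ /=.
  by case: fr => _ -> _; rewrite -[s *: 1]/(s * 1) mulr1.
have sYs : smooth_fun A (fun q => Y q - s).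
  rewrite YsE => psi Apsi.
  apply: (@smooth_on_crd _ (o + s *: e2) (cran psi) (x \o cinv psi)).
    exact: (cran_open sM).
  by have [] := imm Apsi.
have rp : cran phi (cmap phi p) by exists p.
have Js : jac (X \o cinv phi) ((fun q => Y q - s) \o cinv phi) (cmap phi p) != 0.
  have dY := smooth_on_diff (smooth_fun_crd e2 Aphi) rp.
  have pYs i : partial i ((fun q => Y q - s) \o cinv phi) (cmap phi p) =
      partial i (Y \o cinv phi) (cmap phi p).
    have := (has_partialD (has_partialP i dY) (has_partial_cst i (cmap phi p) (- s))).2.
    by rewrite addr0.
  by rewrite /jac (pYs 0) (pYs 1).
have [g [r [sg [gp gO] _ gmap _]]] := coordinate_chart sM (smooth_fun_crd e1) sYs oQ Qp Aphi dp Js.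
exists g; split => //.
pose T := frame_mx e1 e2 e3.
(* [T] turns the frame into the standard basis; the translation takes [o] to the origin and removes
   the phase and the height. *)
exists T, (- (o *m T) - row3 0 s d); split.
- exact: frame_mx_orthogonal.
- rewrite frame_mx_det; case: fr => e11 e22 e12.
  by rewrite lagrange_identity e11 e22 e12 expr0n subr0 mulr1.
move=> q /gO/lf[Zq _]; rewrite addrA -mulmxBl mul_frame_mx /p_surface gmap vec2_0 vec2_1.
apply/rowP => j; rewrite !mxE; case: j => -[|[|[|//]]] j3 /=; rewrite ?subr0 //.
by rewrite -[LHS]/(Z q - d) Zq addrK.
Qed.
End surface.

Theorem theorem3p2 (R : realType) (M : topologicalType)
    (A : set (chart R M)) (x : M -> 'rV[R]_3) (K : M -> R)
    (o e1 e2 : 'rV[R]_3) :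
  smooth_surface A -> connected [set: M] ->
  smooth_immersion A x -> is_gauss_curvature A x K ->
  (forall O : set M, open O -> O !=set0 ->
     ~ (forall p, O p -> grad_vanishes_at A x K p)) ->
  cartesian_frame e1 e2 ->
  parallel_K_contours x K o e1 e2 ->
  area_invariant A x o e1 e2 ->
  exists k c : R,
    [/\ k != 0, c != 0 & locally_congruent A x (p_surface k c)].
Proof.
move=> sM conM imm gK nograd fr par inv.
have [[p0]|noM] := pselect (inhabited M); last first.
  (* Connectedness does not exclude an empty M, where the congruence holds vacuously. *)
  exists 1, 1; split; [exact: oner_neq0|exact: oner_neq0|move=> p].
  by exfalso; apply: noM.
have [phi0 [p1 [A0 dp J0 K0]]] := regular_point o sM imm gK fr p0 nograd.
have [k [a [k0 a0 nf]]] := global_normal_form sM imm gK fr par inv conM A0 dp J0 K0.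
exists k, (a / k); split => //; first by rewrite mulf_neq0 ?invr_eq0 // lt0r_neq0.
by move=> p; exact: (model_chart sM imm gK fr par inv p k0 a0 nf).
Qed.
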